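(* Let $\mathbb{T}=\{z\in\mathbb{C}:|z|=1\}$ and let $\mu$ be a finite, complex Borel measure on $\mathbb{T}$ with $\operatorname{supp}(\mu) \neq \mathbb{T}$ and $\mu(\mathbb{T}) \neq 0$. Moreover, let $$g(w) = \int_{\mathbb{T}} \frac{\mu(d\zeta)}{1-\overline{\zeta}w}, \qquad w \in \mathbb{C} \setminus \operatorname{supp}(\mu).$$ Then for every $p>1$ we have $$\sum_{g(w)=0} \operatorname{dist}(w, \operatorname{supp}(\mu))^p < \infty,$$ where the sum is over all zeros of $g$ in $\mathbb{C} \setminus \operatorname{supp}(\mu)$ and each zero is counted according to its order.
   Context: $\operatorname{supp}(\mu)$ denotes the topological (closed) support of $\mu$, i.e. of its total variation measure $|\mu|$. The function $g$ is holomorphic on $\mathbb{C}\setminus\operatorname{supp}(\mu)$. *)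

(* Defs.v *)
From HB Require Import structures.
From mathcomp Require Import all_boot all_order all_algebra.
From mathcomp Require Import complex.
From mathcomp Require Import all_classical all_reals all_analysis.

Set Implicit Arguments.
Unset Strict Implicit.
Unset Printing Implicit Defensive.

Import Order.TTheory GRing.Theory Num.Theory.
Import numFieldNormedType.Exports.

Local Open Scope classical_set_scope.
Local Open Scope ring_scope.

(* R[i], typed as a numClosedFieldType so that it inherits the topology and the
   normed-module structure that numFieldNormedType puts on numeric fields.
   Its norm `|z| takes values in R[i]; Normc.normc z : R is the same real number
   seen in R. *)
Definition Cplx (R : realType) : numClosedFieldType := R[i].

(* A finite complex measure: a countably additive complex-valued set function.
   mu set0 = 0 follows; values on non-measurable sets are irrelevant. *)
Record complex_measure d (T : measurableType d) (R : realType) := ComplexMeasure {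
  cmeasure :> set T -> Cplx R;
  cmeasure_sigma_additive : forall F : nat -> set T,
    (forall n, measurable (F n)) -> trivIset [set: nat] F ->
    (fun n => \sum_(0 <= i < n) cmeasure (F i)) @ \oo
      --> cmeasure (\bigcup_n F n) }.

Section real_imaginary_parts.
Context d (T : measurableType d) (R : realType) (mu : complex_measure T R).

Definition cmeasure_re (A : set T) : \bar R := (complex.Re (mu A))%:E.
Definition cmeasure_im (A : set T) : \bar R := (complex.Im (mu A))%:E.

Lemma cmeasure0 : mu set0 = 0.
Proof.
have trivF : trivIset [set: nat] (fun=> set0 : set T) by exact: trivIset_set0.
have := @cmeasure_sigma_additive _ _ _ mu (fun=> set0)
  (fun=> measurable0) trivF.
rewrite bigcup0// => /cvgP /cvg_series_cvg_0.
move=> H; rewrite -(cvg_lim (@norm_hausdorff _ _) H).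
by rewrite (cvg_lim (@norm_hausdorff _ _) (cvg_cst _)).
Qed.

Lemma normr_Re_le (z : Cplx R) : (`|complex.Re z|%:C%C : Cplx R) <= `|z|.
Proof. exact: normc_ge_Re. Qed.

Lemma normr_Im_le (z : Cplx R) : (`|complex.Im z|%:C%C : Cplx R) <= `|z|.
Proof.
rewrite (normc_def z) lecR -sqrtr_sqr.
by rewrite ler_wsqrtr// lerDr sqr_ge0.
Qed.

Lemma cvg_part (f : {additive Cplx R -> R})
    (lef : forall z, (`|f z|%:C%C : Cplx R) <= `|z|)
    (u : nat -> Cplx R) (l : Cplx R) :
  u @ \oo --> l -> (fun n => f (u n)) @ \oo --> f l.
Proof.
move=> /cvgrPdist_lt ul; apply/cvgrPdist_lt => e e0.
have e0' : (0 : Cplx R) < e%:C%C by rewrite ltcR.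
have := ul _ e0'; apply: filterS => n.
rewrite -raddfB => H; rewrite -ltcR; exact: le_lt_trans (lef _) H.
Qed.

Lemma cmeasure_part_sigma_additive (f : {additive Cplx R -> R})
    (lef : forall z, (`|f z|%:C%C : Cplx R) <= `|z|) :
  semi_sigma_additive (fun A => (f (mu A))%:E).
Proof.
move=> F mF tF _.
have cvf := cvg_part lef (cmeasure_sigma_additive mF tF).
have -> : (fun n => \sum_(0 <= i < n) (f (mu (F i)))%:E)%E =
    (fun n => (f (\sum_(0 <= i < n) mu (F i)))%:E).
  by apply/funext => n; rewrite raddf_sum sumEFin.
by apply: cvg_EFin; [exact: nearW | exact: cvf].
Qed.

Lemma cmeasure_re_sigma_additive : semi_sigma_additive cmeasure_re.
Proof. exact: (cmeasure_part_sigma_additive normr_Re_le). Qed.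

Lemma cmeasure_im_sigma_additive : semi_sigma_additive cmeasure_im.
Proof. exact: (cmeasure_part_sigma_additive normr_Im_le). Qed.

Lemma cmeasure_re0 : cmeasure_re set0 = 0%E.
Proof. by rewrite /cmeasure_re cmeasure0. Qed.

Lemma cmeasure_im0 : cmeasure_im set0 = 0%E.
Proof. by rewrite /cmeasure_im cmeasure0. Qed.

HB.instance Definition _ := isCharge.Build _ _ _ cmeasure_re
  cmeasure_re0 (fun _ _ => isT) cmeasure_re_sigma_additive.

HB.instance Definition _ := isCharge.Build _ _ _ cmeasure_im
  cmeasure_im0 (fun _ _ => isT) cmeasure_im_sigma_additive.

End real_imaginary_parts.

Definition total_variation d (T : measurableType d) (R : realType)
    (mu : complex_measure T R) (A : set T) : \bar R :=
  ereal_sup [set (\sum_(0 <= n <oo) (Normc.normc (mu (F n)))%:E)%E | F in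
    [set F : nat -> set T | [/\ forall n, measurable (F n),
       trivIset [set: nat] F & \bigcup_n F n = A]]].

(* Integral against a signed measure, as the difference of the integrals against
   the two parts of its Jordan decomposition; the value does not depend on
   the Hahn decomposition that is picked. *)
Definition charge_integral d (T : measurableType d) (R : realType)
    (nu : {charge set T -> \bar R}) (f : T -> R) : R :=
  let nuPN := projT2 (cid (projT2 (cid (Hahn_decomposition nu)))) in
  (\int[jordan_pos nuPN]_x f x - \int[jordan_neg nuPN]_x f x)%R.

Definition complex_integral d (T : measurableType d) (R : realType)
    (mu : complex_measure T R) (f : T -> Cplx R) : Cplx R :=
  let u x := complex.Re (f x) in
  let v x := complex.Im (f x) in
  let mu1 : {charge set T -> \bar R} := cmeasure_re mu in
  let mu2 : {charge set T -> \bar R} := cmeasure_im mu in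
  ((charge_integral mu1 u - charge_integral mu2 v)
     +i* (charge_integral mu2 u + charge_integral mu1 v))%C.

Definition unit_circle (R : realType) : set (Cplx R) := [set z | `|z| = 1].

(* The unit circle as a type, with the topology induced by R[i]. *)
Definition circle (R : realType) : Type := set_type (@unit_circle R).

Section circle.
Context (R : realType).

HB.instance Definition _ := Choice.on (circle R).
HB.instance Definition _ :=
  Topological.copy (circle R) (set_type (@unit_circle R)).

Lemma unit_circle1 : (1 : Cplx R) \in @unit_circle R.
Proof. by rewrite inE /unit_circle/= normr1. Qed.

HB.instance Definition _ :=
  isPointed.Build (circle R) (exist _ (1 : Cplx R) unit_circle1).

End circle.

Definition borel_circle (R : realType) :=
  g_sigma_algebraType (@open (circle R)).

Definition circle_val (R : realType) (z : borel_circle R) : Cplx R :=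
  \val (z : circle R).

(* The closed support, inside the circle, of the total variation measure. *)
Definition closed_support (R : realType) (mu : complex_measure (borel_circle R) R) :
    set (circle R) :=
  [set x | forall U : set (circle R),
     open U -> U x -> (0 < total_variation mu U)%E].

Definition support_in_plane (R : realType)
    (mu : complex_measure (borel_circle R) R) : set (Cplx R) :=
  [set circle_val z | z in closed_support mu].

(* Meaningful for w outside the support. If such a w lies on the circle, the
   integrand takes the junk value 0^-1 = 0 at z = w, a point which has a
   neighborhood of zero total variation. *)
Definition cauchy_transform (R : realType)
    (mu : complex_measure (borel_circle R) R) (w : Cplx R) : Cplx R :=
  complex_integral mu (fun z => (1 - (circle_val z)^* * w)^-1).

Definition dist (R : realType) (w : Cplx R) (A : set (Cplx R)) : R :=
  inf [set Normc.normc (w - z) | z in A].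

(* The order of g at w: the largest n such that g is, near w, the product of
   (z - w)^n with a holomorphic function; +oo if there is no largest one, i.e.
   when g vanishes identically near w. *)
Definition zero_order (R : realType) (g : Cplx R -> Cplx R) (w : Cplx R) :
    \bar R :=
  ereal_sup [set (n%:R)%:E | n in [set n : nat | exists h : Cplx R -> Cplx R,
    \forall z \near w, derivable h z 1 /\ g z = (z - w) ^+ n * h z]].

(* Main.v *)
Require Import Defs.
From HB Require Import structures.
From mathcomp Require Import all_boot all_order all_algebra.
From mathcomp Require Import cyclic separable cyclotomic.
From mathcomp Require Import complex.
From mathcomp Require Import all_classical all_reals all_analysis measurable_realfun.
From mathcomp Require Import zify ring lra.

Set Implicit Arguments.
Unset Strict Implicit.
Unset Printing Implicit Defensive.

Import Order.TTheory GRing.Theory Num.Theory.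
Import numFieldNormedType.Exports.

Local Open Scope classical_set_scope.
Local Open Scope ring_scope.

(** The transform [g] is bounded by [M / dist(w, S)].  Fix a scale [delta] and
    take a finite set [E] of about [1 / delta] points of the disc [|e| < 1]
    such that, for every [z] on the circle, [z E] is [delta / 5]-dense in
    [1 - 2 delta <= |w| <= 1].  Near a point [z e] close to zeros at distance
    about [delta] from [S], dividing out these zeros gives
    [|g (z e)| <= 2^-m C / delta] with [m] their number.  The maximum
    principle for [z |-> prod_(e in E) g (z e)], whose value at [0] is
    [g(0)^|E|], bounds the number of zeros at scale [delta] by
    [C' |E| log (C / delta)], hence [sum dist^p] by
    [C'' sum_j (E0 + j) 2^(j (1 - p))].  Zeros outside the disc are handled by
    the inversion [w |-> 1 / w], which turns [g] into [- u^m] times the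
    Cauchy-type transform of [zeta^m mu], for the smallest [m >= 1] with a
    nonzero moment.  Quotients of [g] by linear factors are again Cauchy-type
    transforms, so that only the maximum principle for uniform limits of
    polynomials is needed. *)

(** * Maximum principle for uniform limits of polynomials *)

(** The obstacle is that zeros are weighed by their distance to [S], not to the circle. The
    transform continues across the gaps of the support, so zeros may lie on the circle itself, where
    the weight [1 - |w|] of Jensen's formula vanishes. The points [z e] stay strictly inside the
    disc, at distance at least [delta / 10] from [S], so [g] is under control at all of them. A
    point close to a zero at scale [delta] is in turn the centre of a disc of radius [3 delta / 5]
    that avoids [S], although it may cross the circle. Since the net is dense after every rotation
    [z], each zero gains its factor [1/2] at every point of the circle, which is what a maximum
    principle needs. The net has about [2^j] points at scale [2^-j], whence the threshold [p > 1].
    The lower bound at the centre is [g(0) = mu(T)]. The hypothesis on the support enters through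
    [nonzero_moment]: for normalized Lebesgue measure [g] is [1] inside the disc and [0] outside. *)

Section modulus.
Context {R : realType}.
Implicit Types z w : Cplx R.
Local Notation N := (@Normc.normc R).

Lemma modulusE z : `|z| = ((N z)%:C)%C :> Cplx R.
Proof. by rewrite normc_def; case: z. Qed.

Lemma modulus_ge0 z : 0 <= N z.
Proof. by case: z => a b; exact: sqrtr_ge0. Qed.

Lemma modulus0 : N (0 : Cplx R) = 0.
Proof. exact: Normc.normc0. Qed.

Lemma modulus1 : N (1 : Cplx R) = 1.
Proof. exact: Normc.normc1. Qed.

Lemma modulus_eq0 z : (N z == 0) = (z == 0).
Proof.
apply/eqP/eqP => [/Normc.eq0_normc//|->]; exact: modulus0.
Qed.

Lemma modulus_gt0 z : (0 < N z) = (z != 0).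
Proof. by rewrite lt_neqAle modulus_ge0 andbT eq_sym modulus_eq0. Qed.

Lemma modulusM z w : N (z * w) = N z * N w.
Proof. exact: Normc.normcM. Qed.

Lemma modulusV z : N z^-1 = (N z)^-1.
Proof. exact: Normc.normcV. Qed.

Lemma modulusX z n : N (z ^+ n) = N z ^+ n.
Proof. by elim: n => [|n IH]; rewrite ?expr0 ?modulus1// !exprS modulusM IH. Qed.

Lemma modulus_prod (I : Type) (s : seq I) (F : I -> Cplx R) :
  N (\prod_(i <- s) F i) = \prod_(i <- s) N (F i).
Proof.
by elim: s => [|i s IH]; rewrite ?big_nil ?modulus1// !big_cons modulusM IH.
Qed.

Lemma modulusN z : N (- z) = N z.
Proof. exact: normcN. Qed.

Lemma modulusB z w : N (z - w) = N (w - z).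
Proof. by rewrite -modulusN opprB. Qed.

Lemma modulusD_le z w : N (z + w) <= N z + N w.
Proof. exact: le_normcD. Qed.

Lemma modulusB_le z w : N (z - w) <= N z + N w.
Proof. by rewrite -(modulusN w) modulusD_le. Qed.

Lemma modulus_distD (z w t : Cplx R) : N (z - t) <= N (z - w) + N (w - t).
Proof.
have -> : z - t = (z - w) + (w - t) by ring.
exact: modulusD_le.
Qed.

Lemma modulus_sum_le (I : Type) (s : seq I) (F : I -> Cplx R) :
  N (\sum_(i <- s) F i) <= \sum_(i <- s) N (F i).
Proof.
elim/big_rec2: _ => [|i y x _ ih]; first by rewrite modulus0.
exact: le_trans (modulusD_le _ _) (lerD (lexx _) ih).
Qed.

Lemma modulus_real (r : R) : N (r%:C)%C = `|r|.
Proof. by rewrite /= expr0n/= addr0 sqrtr_sqr. Qed.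

Lemma modulus_nat n : N (n%:R : Cplx R) = n%:R.
Proof.
have -> : (n%:R : Cplx R) = ((n%:R : R)%:C)%C by rewrite rmorph_nat.
by rewrite modulus_real ger0_norm.
Qed.

Lemma modulus_conj z : N (z^*) = N z.
Proof. by case: z => a b /=; rewrite sqrrN. Qed.

Lemma modulus_Re z : `|complex.Re z| <= N z.
Proof.
case: z => a b /=; rewrite -sqrtr_sqr; apply: ler_wsqrtr.
by rewrite lerDl sqr_ge0.
Qed.

Lemma modulus_Im z : `|complex.Im z| <= N z.
Proof.
case: z => a b /=; rewrite -sqrtr_sqr; apply: ler_wsqrtr.
by rewrite lerDr sqr_ge0.
Qed.

Lemma modulus_le_ReIm z : N z <= `|complex.Re z| + `|complex.Im z|.
Proof.
case: z => a b /=; rewrite -[leRHS]ger0_norm ?addr_ge0// -sqrtr_sqr.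
apply: ler_wsqrtr.
rewrite sqrrD !real_normK ?num_real//; have := normr_ge0 a; have := normr_ge0 b.
by move=> ? ?; rewrite addrAC lerDl mulrn_wge0// mulr_ge0.
Qed.

End modulus.
#[export] Hint Extern 0 (is_true (_ <= Normc.normc _)) => exact: modulus_ge0 : core.

Section maximum_principle.
Context {R : realType}.
Local Notation C := (Cplx R).
Local Notation N := (@Normc.normc R).

Lemma prim_root_exists n : (0 < n)%N -> exists z : C, n.-primitive_root z.
Proof.
move=> n_gt0.
have [r rE] := closed_field_poly_normal ('X^n - 1 : {poly C}).
rewrite (monicP _) ?monicXnsubC// scale1r in rE.
have rn1 : all n.-unity_root r by apply/allP => z; rewrite -root_prod_XsubC -rE.
have sz_r : (n < (size r).+1)%N.
  by rewrite -(size_prod_XsubC r id) -rE size_XnsubC.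
have [|z _ zP] := hasP (has_prim_root n_gt0 rn1 _ sz_r); last by exists z.
by rewrite -separable_prod_XsubC -rE separable_Xn_sub_1// pnatr_eq0 -lt0n.
Qed.

Lemma sum_prim_rootX (n k : nat) (z : C) : n.-primitive_root z -> (0 < k < n)%N ->
  \sum_(i < n) (z ^+ i) ^+ k = 0.
Proof.
move=> zP /andP[k0 kn].
have zk1 : z ^+ k - 1 != 0.
  by rewrite subr_eq0 -(expr0 z) (eq_prim_root_expr zP) /eqn mod0n modn_small// -lt0n.
apply: (mulfI zk1); rewrite mulr0.
under eq_bigr do rewrite exprAC.
by rewrite -subrX1 -exprM mulnC exprM (prim_expr_order zP) expr1n subrr.
Qed.

(** Averaging over the [n]-th roots of unity kills every monomial of degree between [1] and [n - 1].
    This exact discrete mean value property takes the place of an integral over the circle. *)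
Lemma poly_mean_value (P : {poly C}) (n : nat) (z r : C) : n.-primitive_root z ->
  (size P <= n)%N -> \sum_(i < n) P.[r * z ^+ i] = n%:R * P.[0].
Proof.
move=> zP szP; have n0 := prim_order_gt0 zP.
under eq_bigr do rewrite (horner_coef_wide _ szP).
rewrite exchange_big/= horner_coef0.
rewrite [LHS](bigD1 (Ordinal n0))//= [X in _ + X]big1 ?addr0.
  by under eq_bigr do rewrite mulr1; rewrite sumr_const card_ord mulr_natl.
move=> k k0.
under eq_bigr do rewrite exprMn mulrA.
rewrite -mulr_sumr (sum_prim_rootX zP) ?mulr0//.
rewrite ltn_ord andbT lt0n; apply: contra k0 => /eqP k0.
by apply/eqP/val_inj.
Qed.

(** The bound is part of the notion so that stability under products needs neither continuity nor
    compactness. *)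
Definition poly_approx (r : R) (f : C -> C) :=
  (exists B, forall z, N z <= r -> N (f z) <= B) /\
  (forall e : R, 0 < e -> exists P : {poly C},
     forall z, N z <= r -> N (f z - P.[z]) <= e).

Lemma poly_approx_max (r : R) (f : C -> C) (B : R) : 0 <= r -> poly_approx r f ->
  (forall z, N z = r -> N (f z) <= B) -> N (f 0) <= B.
Proof.
move=> r0 [_ apf] fB; apply/ler_addgt0Pr => e e0.
have [P Pf] := apf _ (divr_gt0 e0 (ltr0Sn _ 1)).
(* One node more than [size P] keeps the number of nodes positive when [P] is zero. *)
have [z zP] := @prim_root_exists (size P).+1 isT.
have := poly_mean_value (r%:C)%C zP (leqnSn (size P)).
set n := (size P).+1 => mv.
have z1 i : N (z ^+ i) = 1.
  have : N z ^+ n = 1 by rewrite -modulusX (prim_expr_order zP) modulus1.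
  move/eqP; rewrite modulusX pexpr_eq1// => /eqP ->; by rewrite expr1n.
have NP : n%:R * N P.[0] <= n%:R * (B + e / 2).
  rewrite -[leLHS](_ : N (n%:R * P.[0]) = _); last by rewrite modulusM modulus_nat.
  rewrite -mv; apply: le_trans (modulus_sum_le _ _) _.
  rewrite [leRHS]mulr_natl.
  have -> : (B + e / 2) *+ n = \sum_(i < n) (B + e / 2) by rewrite sumr_const card_ord.
  apply: ler_sum => i _.
  have Nr : N ((r%:C)%C * z ^+ i) = r by rewrite modulusM z1 mulr1 modulus_real ger0_norm.
  have := fB _ Nr; have := Pf ((r%:C)%C * z ^+ i); rewrite Nr => /(_ (lexx r)).
  have := modulus_distD (P.[(r%:C)%C * z ^+ i]) (f ((r%:C)%C * z ^+ i)) 0.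
  rewrite !subr0 modulusB; lra.
rewrite ler_pM2l ?ltr0n// in NP.
have := Pf 0; rewrite modulus0 => /(_ r0).
have := modulus_distD (f 0) P.[0] 0; rewrite !subr0; lra.
Qed.

Lemma poly_approx_cst (r : R) (c : C) : poly_approx r (fun=> c).
Proof.
split; first by exists (N c).
by move=> e e0; exists c%:P => z _; rewrite hornerC subrr modulus0 ltW.
Qed.

Lemma poly_approxM (r : R) (f g : C -> C) :
  poly_approx r f -> poly_approx r g -> poly_approx r (fun z => f z * g z).
Proof.
move=> [[A fA] apf] [[B gB] apg]; split.
  by exists (A * B) => z zr; rewrite modulusM ler_pM ?fA ?gB.
move=> e e0.
have A0 : 0 < `|A| + 1 by rewrite ltr_wpDl.
have B0 : 0 < `|B| + 1 by rewrite ltr_wpDl.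
set d := Num.min 1 (e / (2 * (`|A| + `|B| + 1))).
have AB0 : 0 < 2 * (`|A| + `|B| + 1) by rewrite mulr_gt0// ltr_wpDl// addr_ge0.
have d0 : 0 < d by rewrite lt_min ltr01/= divr_gt0.
have d1 : d <= 1 by rewrite ge_min lexx.
have de : d * (2 * (`|A| + `|B| + 1)) <= e.
  by rewrite -ler_pdivlMr// ge_min lexx orbT.
have [P Pf] := apf _ d0; have [Q Qg] := apg _ d0.
exists (P * Q) => z zr; rewrite hornerM.
(* Only the bounds of [f] and [g] occur here, none of [P] or [Q]; [d <= 1] absorbs the product of
   the two errors. *)
have -> : f z * g z - P.[z] * Q.[z] =
    f z * (g z - Q.[z]) + g z * (f z - P.[z]) - (f z - P.[z]) * (g z - Q.[z]).
  by ring.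
have := Pf _ zr; have := Qg _ zr.
set x := f z - _; set y := g z - _ => yd xd.
have fzA : N (f z) <= `|A| := le_trans (fA _ zr) (ler_norm _).
have gzB : N (g z) <= `|B| := le_trans (gB _ zr) (ler_norm _).
apply: le_trans (modulusB_le _ _) _.
apply: (@le_trans _ _ (`|A| * d + `|B| * d + d * d)).
  apply: lerD; last by rewrite modulusM ler_pM.
  apply: le_trans (modulusD_le _ _) _.
  by rewrite !modulusM lerD// ler_pM.
have dd : d * d <= d * 1 by rewrite ler_wpM2l// ltW.
have := normr_ge0 A; have := normr_ge0 B; nra.
Qed.

Lemma poly_approx_prod (r : R) (I : eqType) (s : seq I) (F : I -> C -> C) :
  (forall i, i \in s -> poly_approx r (F i)) ->
  poly_approx r (fun z => \prod_(i <- s) F i z).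
Proof.
elim: s => [_|i s IH Fs].
  under [X in poly_approx _ X]eq_fun do rewrite big_nil.
  exact: poly_approx_cst.
under [X in poly_approx _ X]eq_fun do rewrite big_cons.
apply: poly_approxM; first by apply: Fs; rewrite mem_head.
by apply: IH => j js; apply: Fs; rewrite inE js orbT.
Qed.

Lemma poly_approx_affine (r r' : R) (f : C -> C) (a c : C) :
  (forall z, N z <= r' -> N (a + c * z) <= r) -> poly_approx r f ->
  poly_approx r' (fun z => f (a + c * z)).
Proof.
move=> h [[B fB] apf]; split; first by exists B => z /h; exact: fB.
move=> e /apf[P Pf]; exists (P \Po (a%:P + c *: 'X)) => z /h/Pf.
by rewrite horner_comp !hornerE.
Qed.

End maximum_principle.

(** * Cauchy-type transforms *)

Lemma geometric_small (R : realType) (D q e : R) : 0 <= D -> 0 <= q < 1 -> 0 < e ->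
  exists n, D * q ^+ n <= e.
Proof.
move=> D0 /andP[q0 q1] e0.
have qn1 : `|q| < 1 by rewrite ger0_norm.
have /cvgrPdist_lt/(_ (e / (D + 1))) := cvg_expr qn1.
case=> [|n _ /(_ n (leqnn n))]; first by rewrite divr_gt0// ltr_wpDl.
rewrite /= sub0r normrN ger0_norm ?exprn_ge0//.
rewrite ltr_pdivlMr ?ltr_wpDl// => h; exists n.
by have := exprn_ge0 n q0; nra.
Qed.

(* [phi] is [zeta^*] for the Cauchy transform and [zeta] for its image under
   [w |-> 1 / w].  Bounds are only required on [S]: for [u] on the circle the
   kernel [(1 - phi x * u)^-1] is unbounded near a point outside [S]. *)
Record cauchy_functional (R : realType) (X : Type) (S : set X)
    (phi : X -> Cplx R) (adm : set (X -> Cplx R))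
    (L : (X -> Cplx R) -> Cplx R) (M : R) : Prop := CauchyFunctional {
  cf_supp : S !=set0;
  cf_phi : forall x, Normc.normc (phi x) = 1;
  cf_adm_cst : forall c, adm (fun=> c);
  cf_admD : forall f g, adm f -> adm g -> adm (fun x => f x + g x);
  cf_admM : forall f g, adm f -> adm g -> adm (fun x => f x * g x);
  cf_adm_phi : adm phi;
  cf_adm_inv : forall u c, 0 < c ->
    (forall x, S x -> c <= Normc.normc (1 - phi x * u)) ->
    adm (fun x => (1 - phi x * u)^-1);
  cf_bounded : forall f, adm f ->
    exists2 B, 0 <= B & forall x, S x -> Normc.normc (f x) <= B;
  cf_additive : forall f g, adm f -> adm g ->
    L (fun x => f x + g x) = L f + L g;
  cf_scalar : forall c f, adm f -> L (fun x => c * f x) = c * L f;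
  cf_le : forall f B, adm f -> (forall x, S x -> Normc.normc (f x) <= B) ->
    Normc.normc (L f) <= M * B }.

Section cauchy_functional_theory.
Context {R : realType} {X : Type} {S : set X} {phi : X -> Cplx R}
  {adm : set (X -> Cplx R)} {L : (X -> Cplx R) -> Cplx R} {M : R}.
Context (cf : cauchy_functional S phi adm L M).
Local Notation C := (Cplx R).
Local Notation N := (@Normc.normc R).

(** As [phi x] is unimodular, [|1 - phi x * u| = |u - (phi x)^-1|]: this is the distance from [u] to
    the poles of the kernel. *)
Definition pole_dist (u : C) : R := inf [set N (1 - phi x * u) | x in S].
Local Notation d := pole_dist.

Lemma pole_dist_le u x : S x -> d u <= N (1 - phi x * u).
Proof.
move=> Sx; apply: ge_inf; last by exists x.
by exists 0 => _ [y _ <-]; exact: modulus_ge0.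
Qed.

Lemma pole_dist_ge u c : (forall x, S x -> c <= N (1 - phi x * u)) -> c <= d u.
Proof.
move=> h; have [x Sx] := cf_supp cf.
by apply: lb_le_inf; [exists (N (1 - phi x * u)), x|move=> _ [y Sy <-]; exact: h].
Qed.

Lemma pole_dist_ge0 u : 0 <= d u.
Proof. by apply: pole_dist_ge => x _; exact: modulus_ge0. Qed.

Lemma pole_dist_lip u v : d u <= d v + N (u - v).
Proof.
rewrite -lerBlDr; apply: pole_dist_ge => x Sx; rewrite lerBlDr.
apply: le_trans (pole_dist_le u Sx) _.
have -> : 1 - phi x * u = (1 - phi x * v) - phi x * (u - v) by ring.
by apply: le_trans (modulusB_le _ _) _; rewrite modulusM (cf_phi cf) mul1r.
Qed.

Lemma pole_dist_ge1B u : 1 - N u <= d u.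
Proof.
apply: pole_dist_ge => x Sx.
have := modulus_distD 1 (phi x * u) 0.
by rewrite !subr0 modulus1 modulusM (cf_phi cf) mul1r; lra.
Qed.

Lemma pole_dist_le1D u : d u <= 1 + N u.
Proof.
have [x Sx] := cf_supp cf; apply: le_trans (pole_dist_le u Sx) _.
by have := modulusB_le 1 (phi x * u); rewrite modulus1 modulusM (cf_phi cf) mul1r.
Qed.

Lemma cf_norm_ge0 : 0 <= M.
Proof.
have h : N (L (fun=> 1)) <= M * 1.
  apply: (cf_le cf); first exact: (cf_adm_cst cf 1).
  by move=> x _; rewrite modulus1.
by rewrite mulr1 in h; exact: le_trans (modulus_ge0 _) h.
Qed.

(** The bound [cf_le] with [B = 0] makes [L] blind outside [S]. Kernel identities can therefore be
    checked on [S] alone, where no denominator vanishes. *)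
Lemma cf_eq f g : adm f -> adm g -> (forall x, S x -> f x = g x) -> L f = L g.
Proof.
move=> af ag fg; apply/eqP; rewrite -subr_eq0 -modulus_eq0.
rewrite eq_le modulus_ge0 andbT.
rewrite -mulN1r -(cf_scalar cf)// -(cf_additive cf)//; last first.
  exact: (cf_admM cf (cf_adm_cst cf (-1)) ag).
rewrite -(mulr0 M); apply: (cf_le cf) => //.
  apply: (cf_admD cf af); exact: (cf_admM cf (cf_adm_cst cf (-1)) ag).
by move=> x Sx; rewrite fg// mulN1r subrr modulus0.
Qed.

Definition ctransform (k : X -> C) (u : C) : C :=
  L (fun x => k x * (1 - phi x * u)^-1).
Local Notation T := ctransform.

Lemma pole_neq0 u x : 0 < d u -> S x -> 1 - phi x * u != 0.
Proof.
by move=> du Sx; rewrite -modulus_gt0 (lt_le_trans du)// pole_dist_le.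
Qed.

Lemma adm_inv u : 0 < d u -> adm (fun x => (1 - phi x * u)^-1).
Proof. by move=> du; apply: (cf_adm_inv cf du) => x; exact: pole_dist_le. Qed.

Lemma inv_pole_le u x : 0 < d u -> S x -> N (1 - phi x * u)^-1 <= (d u)^-1.
Proof.
move=> du Sx; rewrite modulusV lef_pV2 ?posrE ?modulus_gt0 ?pole_neq0//.
exact: pole_dist_le.
Qed.

Lemma ctransform_le k K u : adm k -> (forall x, S x -> N (k x) <= K) -> 0 < d u ->
  N (T k u) <= M * (K / d u).
Proof.
move=> ak kK du; apply: (cf_le cf).
  by apply: (cf_admM cf) => //; exact: adm_inv.
by move=> x Sx; rewrite modulusM ler_pM ?inv_pole_le ?kK.
Qed.

(* If the transform of [k] vanishes at [w], then the transform of [kquo k w] is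
   its quotient by [u - w], see [ctransform_sub]. *)
Definition kquo (k : X -> C) (w : C) : X -> C :=
  fun x => k x * (phi x * (1 - phi x * w)^-1).

Lemma adm_kquo k w : adm k -> 0 < d w -> adm (kquo k w).
Proof.
move=> ak dw; apply: (cf_admM cf) => //; apply: (cf_admM cf).
  exact: (cf_adm_phi cf).
exact: adm_inv.
Qed.

Lemma kquo_le k K w x : (N (k x) <= K) -> 0 < d w -> S x -> N (kquo k w x) <= K / d w.
Proof.
move=> kK dw Sx; rewrite !modulusM (cf_phi cf) mul1r.
by rewrite ler_pM ?inv_pole_le.
Qed.

(** This is the resolvent identity: the kernels at [u] and [w] differ by [u - w] times [phi] times
    their product. *)
Lemma ctransform_sub k u w : adm k -> 0 < d u -> 0 < d w ->
  T k u = T k w + (u - w) * T (kquo k w) u.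
Proof.
move=> ak du dw.
have au := adm_inv du; have aw := adm_inv dw; have aq := adm_kquo ak dw.
have akw := cf_admM cf ak aw; have aqu := cf_admM cf aq au.
rewrite /ctransform -(cf_scalar cf)// -(cf_additive cf)//; last first.
  exact: (cf_admM cf (cf_adm_cst cf _) aqu).
apply: cf_eq.
- exact: (cf_admM cf).
- by apply: (cf_admD cf) => //; exact: (cf_admM cf (cf_adm_cst cf _) aqu).
move=> x Sx; rewrite /kquo; field.
by rewrite (pole_neq0 du Sx) (pole_neq0 dw Sx).
Qed.

(** Iterating [ctransform_sub] at [a] gives the Taylor expansion with a remainder that is again a
    transform. *)
Lemma ctransform_expansion k a z n : adm k -> 0 < d a -> 0 < d (a + z) ->
  T k (a + z) = \sum_(i < n) z ^+ i * T (iter i (kquo^~ a) k) a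
    + z ^+ n * T (iter n (kquo^~ a) k) (a + z).
Proof.
move=> ak da daz; elim: n => [|n IH].
  by rewrite big_ord0 add0r mul1r.
have an : adm (iter n (kquo^~ a) k).
  by elim: n {IH} => [//|n IH]; exact: adm_kquo.
rewrite IH big_ord_recr/= (ctransform_sub an daz da) exprSr.
have -> : a + z - a = z by ring.
by ring.
Qed.

(** Each division at [a] costs a factor [1 / d a] on the kernel and gains a factor [|z| <= r], so
    the Taylor remainder is geometric of ratio [r / d a]. *)
Lemma ctransform_approx k a r : adm k -> 0 <= r -> r < d a ->
  poly_approx r (fun z => T k (a + z)).
Proof.
move=> ak r0 ra; have da : 0 < d a by exact: le_lt_trans ra.
have [K K0 kK] := cf_bounded cf ak.
have dz z : N z <= r -> d a - r <= d (a + z).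
  move=> zr; have := pole_dist_lip a (a + z).
  have -> : a - (a + z) = - z by ring.
  by rewrite modulusN; lra.
have dar : 0 < d a - r by rewrite subr_gt0.
have dz0 z : N z <= r -> 0 < d (a + z) by move=> /dz; exact: lt_le_trans.
have bnd f B z : adm f -> 0 <= B -> (forall x, S x -> N (f x) <= B) -> N z <= r ->
    N (T f (a + z)) <= M * (B / (d a - r)).
  move=> af B0 fB zr; apply: le_trans (ctransform_le af fB (dz0 _ zr)) _.
  rewrite ler_wpM2l ?cf_norm_ge0// ler_wpM2l// lef_pV2 ?posrE ?dz0//.
  exact: dz.
split; first by exists (M * (K / (d a - r))) => z; exact: bnd.
move=> e e0.
pose E := M * (K / (d a - r)).
have E0 : 0 <= E by rewrite mulr_ge0 ?cf_norm_ge0// divr_ge0// ltW.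
have q1 : 0 <= r / d a < 1.
  by rewrite divr_ge0 ?(ltW da)// ltr_pdivrMr// mul1r.
have [n qn] := geometric_small E0 q1 e0.
exists (\poly_(i < n) T (iter i (kquo^~ a) k) a) => z zr.
rewrite horner_poly (ctransform_expansion n ak da (dz0 _ zr)).
under eq_bigr do rewrite mulrC.
rewrite addrAC subrr add0r modulusM modulusX.
have an : adm (iter n (kquo^~ a) k).
  by elim: (n) => [//|m IH]; exact: adm_kquo.
have kn x : S x -> N (iter n (kquo^~ a) k x) <= K / d a ^+ n.
  move=> Sx; elim: (n) => [|m IH]; first by rewrite expr0 divr1 kK.
  rewrite /= exprSr invfM mulrA; exact: kquo_le.
have Kn0 : 0 <= K / d a ^+ n by rewrite divr_ge0// exprn_ge0// ltW.
apply: le_trans qn.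
apply: le_trans (ler_pM _ _ (_ : _ <= r ^+ n) (bnd _ _ _ an Kn0 kn zr)) _.
- by rewrite exprn_ge0.
- exact: modulus_ge0.
- by rewrite lerXn2r ?nnegrE.
rewrite /E exprMn exprVn le_eqVlt; apply/orP; left; apply/eqP.
field; rewrite expf_neq0 ?gt_eqF//.
Qed.

Definition kquos (k : X -> C) (W : seq C) : X -> C :=
  foldr (fun w f => kquo f w) k W.

Lemma adm_kquos k W : adm k -> {in W, forall w, 0 < d w} -> adm (kquos k W).
Proof.
move=> ak; elim: W => [//|w W IH dW] /=; apply: adm_kquo.
  by apply: IH => v vW; apply: dW; rewrite inE vW orbT.
by apply: dW; rewrite mem_head.
Qed.

(* A single ray from [w] suffices; a point at the boundary of a region where [f]
   vanishes identically then counts as a zero of every order. *)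
Definition vanishes (f : C -> C) (w : C) (n : nat) :=
  exists (B : R) (v : C) (e : R), [/\ 0 < e, N v = 1 &
    forall t : R, 0 < t < e -> N (f (w + (t%:C)%C * v)) <= B * t ^+ n].

(** Zeros are divided out one at a time. Before a further division at [w], the factors already
    removed have order exactly [m] along the ray at [w], while the transform has order at least
    [m + 1]. The quotient is thus [O(t)] on the ray and vanishes at [w]. *)
Lemma vanishes_factor k W (n : C -> nat) : adm k ->
  {in W, forall w, 0 < d w /\ vanishes (T k) w (n w)} ->
  (forall w, count_mem w W <= n w)%N ->
  forall u, 0 < d u -> T k u = \prod_(w <- W) (u - w) * T (kquos k W) u.
Proof.
move=> ak; elim: W => [|w W IH] HW cW u du; first by rewrite big_nil mul1r.
have HW' : {in W, forall v, 0 < d v /\ vanishes (T k) v (n v)}.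
  by move=> v vW; apply: HW; rewrite inE vW orbT.
have {}IH := IH HW' _; have {}IH : forall u, 0 < d u ->
    T k u = \prod_(w <- W) (u - w) * T (kquos k W) u.
  by apply: IH => v; apply: leq_trans (cW v); rewrite /= leq_addl.
have [dw [B [v [e [e0 v1 ve]]]]] := HW w (mem_head _ _).
have aW : adm (kquos k W) by apply: adm_kquos => // y /HW'[].
suff Tw0 : T (kquos k W) w = 0.
  by rewrite IH// (ctransform_sub aW du dw) Tw0 add0r big_cons /=; ring.
have := cW w; rewrite /= eqxx add1n => cw.
set m := count_mem w W in cw.
(* Along the ray a factor at [w] equals [t] in modulus, and a factor at [y != w] stays above
   [|w - y| / 2]. *)
have [c c0 cP] : exists2 c : R, 0 < c & exists2 e1, 0 < e1 & forall t, 0 < t < e1 ->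
    c * t ^+ m <= N (\prod_(y <- W) (w + (t%:C)%C * v - y)).
  rewrite /m; elim: (W) => [|y s [c c0 [e1 e10 IHs]]].
    by exists 1 => //; exists 1 => // t _; rewrite big_nil modulus1 expr0 mulr1.
  have [->|yw] := eqVneq y w.
    exists c => //; exists e1 => // t te; rewrite big_cons modulusM /= eqxx add1n exprS.
    have -> : w + (t%:C)%C * v - w = (t%:C)%C * v by ring.
    case/andP: (te) => t0 _.
    rewrite modulusM v1 mulr1 modulus_real gtr0_norm// mulrCA.
    by rewrite ler_wpM2l ?IHs// ltW.
  have wy0 : 0 < N (w - y) by rewrite modulus_gt0 subr_eq0 eq_sym.
  exists (N (w - y) / 2 * c); first by rewrite mulr_gt0// divr_gt0.
  exists (Num.min e1 (N (w - y) / 2)).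
    by rewrite lt_min e10 divr_gt0.
  move=> t /andP[t0]; rewrite lt_min => /andP[te1 ty].
  rewrite big_cons modulusM /= (negbTE yw) add0n -[leLHS]mulrA; apply: ler_pM.
  - by rewrite divr_ge0.
  - by rewrite mulr_ge0 ?exprn_ge0// ltW.
  - have := modulus_distD (w - y) (w + (t%:C)%C * v - y) 0.
    rewrite !subr0.
    have -> : w - y - (w + (t%:C)%C * v - y) = - ((t%:C)%C * v) by ring.
    rewrite modulusN modulusM v1 mulr1 modulus_real gtr0_norm//; lra.
  - by apply: IHs; rewrite t0.
case: cP => e1 e10 cP.
have [K K0 kK] := cf_bounded cf (adm_kquo aW dw).
have M0 := cf_norm_ge0.
pose D := M * (K / (d w / 2)).
have D0 : 0 <= D by rewrite mulr_ge0// divr_ge0// divr_ge0// ltW.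
have B0 : 0 <= B.
  have := ve (e / 2); rewrite divr_gt0// ltr_pdivrMr// ltr_pMr// ltr1n => /(_ isT).
  move=> /(le_trans (modulus_ge0 _)); rewrite pmulr_lge0// exprn_gt0//.
  by rewrite divr_gt0.
apply/eqP; rewrite -modulus_eq0 eq_le modulus_ge0 andbT.
apply/ler_addgt0Pr => eps eps0; rewrite add0r.
(* The value at [w] is at most [B / c * t] from the quotient at [z] plus [D * t] from
   [ctransform_sub]; [t < eps / Q] makes the sum smaller than [eps]. *)
pose Q := B / c + D + 1.
have Bc0 : 0 <= B / c by rewrite divr_ge0// ltW.
have Q0 : 0 < Q by rewrite /Q; lra.
pose mn := Num.min (Num.min e e1) (Num.min (Num.min 1 (d w / 2)) (eps / Q)).
have mn0 : 0 < mn by rewrite !lt_min e0 e10 ltr01 !divr_gt0.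
pose t := mn / 2.
have t0 : 0 < t by rewrite divr_gt0.
have tmn : t < mn by rewrite /t; lra.
have : t < mn by []; rewrite /mn !lt_min.
move=> /andP[/andP[te te1] /andP[/andP[t1 td] tQ]].
have te' : 0 < t < e by rewrite t0.
have te1' : 0 < t < e1 by rewrite t0.
pose z := w + (t%:C)%C * v.
have zw : N (z - w) = t.
  rewrite /z; have -> : w + (t%:C)%C * v - w = (t%:C)%C * v by ring.
  by rewrite modulusM v1 mulr1 modulus_real gtr0_norm.
have dz : d w / 2 <= d z.
  by have := pole_dist_lip w z; rewrite modulusB zw; lra.
have dz0 : 0 < d z by apply: lt_le_trans dz; rewrite divr_gt0.
have fz : N (T (kquos k W) z) <= B / c * t.
  have ct0 : 0 < c * t ^+ m by rewrite mulr_gt0// exprn_gt0.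
  rewrite -(ler_pM2l ct0).
  apply: (@le_trans _ _ (N (T k z))).
    by rewrite (IH z dz0) modulusM ler_wpM2r// cP.
  apply: le_trans (ve _ te') _.
  have -> : c * t ^+ m * (B / c * t) = B * t ^+ m.+1.
    by rewrite exprSr; field; rewrite gt_eqF.
  rewrite ler_wpM2l// ler_wiXn2l// ltW//.
have := ctransform_sub aW dz0 dw => /(congr1 (fun x => x - (z - w) * T (kquo (kquos k W) w) z)).
rewrite addrK => <-.
apply: le_trans (modulusB_le _ _) _.
have Tq : N (T (kquo (kquos k W) w) z) <= D.
  apply: le_trans (ctransform_le (adm_kquo aW dw) kK dz0) _.
  rewrite ler_wpM2l// ler_wpM2l// lef_pV2 ?posrE// divr_gt0//.
rewrite modulusM zw.
rewrite ltr_pdivlMr// in tQ.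
have : t * N (T (kquo (kquos k W) w) z) <= t * D by rewrite ler_wpM2l// ltW.
rewrite /Q in tQ; nra.
Qed.

End cauchy_functional_theory.

(** * Nets in annuli *)

Section nets.
Context {R : realType}.
Local Notation C := (Cplx R).
Local Notation N := (@Normc.normc R).

(** Splitting off the change of modulus leaves two terms, each at most [N (q - p) / N q]. *)
Lemma modulus_normalize_dist (p q : C) : 1 <= N p -> 1 <= N q ->
  N (q / (N q)%:C%C - p / (N p)%:C%C) <= 2 * N (q - p).
Proof.
move=> p1 q1.
have p0 : N p != 0 by rewrite gt_eqF// (lt_le_trans ltr01).
have q0 : N q != 0 by rewrite gt_eqF// (lt_le_trans ltr01).
have rc (r : R) : r != 0 -> (r%:C)%C != 0 :> C.
  by move=> r0; rewrite -modulus_eq0 modulus_real normr_eq0.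
have -> : q / (N q)%:C%C - p / (N p)%:C%C =
    (q - p) / (N q)%:C%C + p / (N p)%:C%C * ((N p - N q)%:C%C / (N q)%:C%C).
  by rewrite rmorphB /=; field; rewrite !rc.
have Nn (r : R) : 0 <= r -> N (r%:C)%C = r by move=> r0; rewrite modulus_real ger0_norm.
apply: le_trans (modulusD_le _ _) _.
rewrite !modulusM !modulusV (Nn _ (modulus_ge0 p)) (Nn _ (modulus_ge0 q)).
rewrite divff// mul1r modulus_real -mulrDl.
rewrite ler_pdivrMr; last by rewrite (lt_le_trans ltr01).
have pq : `|N p - N q| <= N (q - p).
  rewrite ler_norml; have := modulus_distD p q 0; have := modulus_distD q p 0.
  by rewrite !subr0 (modulusB p q) => ? ?; apply/andP; split; lra.
have := modulus_ge0 (q - p); nra.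
Qed.

Lemma grid_point (m : nat) (s : R) : (0 < m)%N -> -1 <= s <= 1 ->
  exists2 j, (j < (2 * m).+1)%N & `|s - (j%:R / m%:R - 1)| <= m%:R^-1.
Proof.
move=> m0 /andP[s1 s2].
have m0' : 0 < m%:R :> R by rewrite ltr0n.
have x0 : 0 <= (s + 1) * m%:R by rewrite mulr_ge0//; lra.
have /andP[] := truncn_itv x0.
set j := Num.truncn _ => j1 j2; exists j.
  rewrite ltnS -(ler_nat R); apply: le_trans j1 _.
  by rewrite natrM ler_wpM2r//; lra.
have -> : s - (j%:R / m%:R - 1) = ((s + 1) * m%:R - j%:R) / m%:R.
  by field; rewrite gt_eqF.
rewrite ger0_norm ?divr_ge0 ?subr_ge0//.
rewrite ler_pdivrMr// mulVf ?gt_eqF//.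
by move: j2; rewrite -natr1; lra.
Qed.

(** Trigonometry is avoided by projecting a grid on the sides of a square. A quarter turn brings [u]
    into the sector [|y| <= x], where it is the radial projection of [1 + i (y / x)]; that
    projection is 2-Lipschitz outside the open disc. *)
Lemma circle_net (m : nat) : (0 < m)%N -> exists E : seq C,
  [/\ size E = (4 * (2 * m).+1)%N, {in E, forall e, N e = 1} &
      forall u, N u = 1 -> exists2 e, e \in E & N (u - e) <= 2 / m%:R].
Proof.
move=> m0.
pose p (j : nat) : C := (1 +i* (j%:R / m%:R - 1))%C.
pose e (j : nat) : C := p j / (N (p j))%:C%C.
have i1 : N ('i%C : C) = 1 by rewrite /= expr0n/= add0r expr1n sqrtr1.
have p1 j : 1 <= N (p j).
  by have := modulus_Re (p j); rewrite /= normr1.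
exists [seq 'i%C ^+ a * e j | a <- iota 0 4, j <- iota 0 (2 * m).+1]; split.
- by rewrite size_allpairs !size_iota.
- move=> _ /allpairsP[[a j] [_ _ ->]] /=.
  rewrite modulusM modulusX i1 expr1n mul1r modulusM modulusV modulus_real.
  by rewrite ger0_norm// divff// gt_eqF// (lt_le_trans ltr01).
move=> u u1.
have [a a4 [x [y [x0 xy uE]]]] : exists2 a, (a < 4)%N &
    exists x y : R, [/\ 0 < x, `|y| <= x & u = 'i%C ^+ a * (x +i* y)%C].
  case: u u1 => x y u1.
  have xy0 : (x != 0) || (y != 0).
    rewrite -negb_and; apply/negP => /andP[/eqP x0 /eqP y0].
    by move: u1; rewrite x0 y0 modulus0 => /eqP; rewrite eq_sym oner_eq0.
  have i2 : 'i%C ^+ 2 = -1 :> C by rewrite sqr_i.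
  have [xy|yx] := leP `|y| `|x|.
    have x0 : x != 0.
      apply: contraTneq xy0 => x0; move: xy; rewrite x0 normr0 normr_le0 => /eqP ->.
      by rewrite eqxx.
    have [xp|xn] := ltP 0 x.
      by exists 0%N => //; exists x, y; rewrite mul1r; split => //; rewrite -(gtr0_norm xp).
    exists 2%N => //; exists (- x), (- y); split.
    + by rewrite oppr_gt0 lt_neqAle x0.
    + by rewrite normrN -(ler0_norm xn).
    + by rewrite i2; simpc.
  have y0 : y != 0 by apply: contraTneq yx => ->; rewrite normr0 -leNgt.
  have [yp|yn] := ltP 0 y.
    exists 1%N => //; exists y, (- x); split => //.
    + by rewrite normrN -(gtr0_norm yp) ltW.
    + by rewrite expr1; simpc.
  exists 3%N => //; exists (- y), x; split.
  + by rewrite oppr_gt0 lt_neqAle y0.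
  + by rewrite -(ler0_norm yn) ltW.
  + by rewrite exprS i2; simpc.
have yx : -1 <= y / x <= 1.
  by rewrite -ler_norml normrM normfV (gtr0_norm x0) ler_pdivrMr// mul1r.
have [j jm jy] := grid_point m0 yx.
exists ('i%C ^+ a * e j).
  by apply/allpairsP; exists (a, j); rewrite !mem_iota.
rewrite uE -mulrBr modulusM modulusX i1 expr1n mul1r.
pose q : C := (1 +i* (y / x))%C.
have q1 : 1 <= N q by have := modulus_Re q; rewrite /= normr1.
have xC : (x%:C)%C != 0 :> C by rewrite -modulus_eq0 modulus_real normr_eq0 gt_eqF.
have vE : (x +i* y)%C = (x%:C)%C * q :> C.
  by rewrite /q; simpc; rewrite mulrCA divff ?gt_eqF// mulr1.
have v1 : N (x +i* y)%C = 1.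
  by rewrite -u1 uE modulusM modulusX i1 expr1n mul1r.
have qx : x * N q = 1.
  by rewrite -v1 vE modulusM modulus_real gtr0_norm.
have -> : (x +i* y)%C = q / (N q)%:C%C :> C.
  rewrite vE mulrC; congr (_ * _).
  have -> : N q = x^-1 by apply: (mulfI (lt0r_neq0 x0)); rewrite qx divff// gt_eqF.
  by rewrite rmorphV ?unitfE ?gt_eqF// invrK.
apply: le_trans (modulus_normalize_dist (p1 j) q1) _.
rewrite ler_pM2l//; apply: le_trans (modulus_le_ReIm _) _.
by rewrite /= subrr normr0 add0r.
Qed.

(** The error [delta / 5] is split evenly between angle and radius. With [21] radii and
    [4 (40 * 2^k + 1)] angles the size is at most [21 * 4 * 41 * 2^k], whence [3444]. *)
Lemma annulus_net (k : nat) (delta := (2 ^+ k)^-1 : R) : exists E : seq C,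
  [/\ (size E <= 3444 * 2 ^ k)%N, {in E, forall e, N e <= 1 - delta / 10} &
      forall u z, N z = 1 -> 1 - 2 * delta <= N u -> N u <= 1 ->
        exists2 e, e \in E & N (u - e * z) <= delta / 5].
Proof.
have k0 : 0 < 2 ^+ k :> R by rewrite exprn_gt0.
have delta0 : 0 < delta by rewrite invr_gt0.
have delta1 : delta <= 1 by rewrite invf_le1// exprn_ege1// ler1n.
have m0 : (0 < 20 * 2 ^ k)%N by rewrite muln_gt0 expn_gt0.
have [E [sE E1 netE]] := circle_net m0.
(* The radii go down by steps of [delta / 10]; truncation at [0] matters only when [delta] is close
   to [1]. *)
pose r (i : nat) : R := Num.max 0 (1 - i%:R * (delta / 10)).
have r0 i : 0 <= r i by rewrite le_max lexx.
exists [seq (r i)%:C%C * e | i <- iota 1 21, e <- E]; split.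
- rewrite size_allpairs size_iota sE.
  have : (0 < 2 ^ k)%N by rewrite expn_gt0.
  move: (2 ^ k)%N => K; lia.
- move=> x /allpairsP[[i e] [+ eE ->]]; rewrite mem_iota => /andP[i1 _].
  rewrite modulusM (E1 _ eE) mulr1 modulus_real ger0_norm// ge_max /=.
  apply/andP; split; first lra.
  have : 1 <= i%:R :> R by rewrite ler1n.
  nra.
move=> u z z1 ul uu.
have [u' u'1 uE] : exists2 u', N u' = 1 & u = (N u)%:C%C * u'.
  have [->|u0] := eqVneq u 0.
    by exists 1; rewrite ?modulus1// modulus0 mul0r.
  have Nu : N u != 0 by rewrite modulus_eq0.
  exists (u / (N u)%:C%C).
    by rewrite modulusM modulusV modulus_real ger0_norm// divff.
  by rewrite mulrCA divff ?mulr1// -modulus_eq0 modulus_real normr_eq0.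
have z0 : z != 0 by rewrite -modulus_gt0 z1.
have [e eE ue] : exists2 e, e \in E & N (u' / z - e) <= delta / 10.
  have [|e eE h] := netE (u' / z); first by rewrite modulusM modulusV u'1 z1 divr1.
  exists e => //; apply: le_trans h _; rewrite natrM natrX.
  by rewrite le_eqVlt; apply/orP; left; apply/eqP; rewrite /delta; field; rewrite gt_eqF.
have x0 : 0 <= (1 - N u) * 10 / delta.
  by rewrite divr_ge0 ?(ltW delta0)// mulr_ge0// subr_ge0.
have /andP[] := truncn_itv x0; set i := Num.truncn _.
rewrite ler_pdivlMr// ltr_pdivrMr// => i1 i2.
have i20 : (i <= 20)%N.
  rewrite -(ler_nat R) -(ler_pM2r delta0); apply: le_trans i1 _; lra.
(* The radius is rounded inwards, so index [0] never occurs and the net keeps its distance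
   [delta / 10] from the circle. *)
have ri : `|N u - r i.+1| <= delta / 10.
  have iS : i.+1%:R = i%:R + 1 :> R by rewrite -natr1.
  rewrite iS in i2.
  have := modulus_ge0 u; rewrite ler_norml /r iS.
  case: (leP 0 (1 - (i%:R + 1) * (delta / 10))) => h u0; apply/andP; split; lra.
exists ((r i.+1)%:C%C * e).
  by apply/allpairsP; exists (i.+1, e); rewrite mem_iota /= ltnS.
have -> : u - (r i.+1)%:C%C * e * z =
    (N u - r i.+1)%:C%C * u' + (r i.+1)%:C%C * z * (u' / z - e).
  by rewrite {1}uE rmorphB /=; field.
apply: le_trans (modulusD_le _ _) _.
rewrite !modulusM u'1 z1 !mulr1 !modulus_real (ger0_norm (r0 _)).
have r1 : r i.+1 <= 1.
  by rewrite ge_max ler01/= gerBl mulr_ge0// divr_ge0// ltW.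
have := modulus_ge0 (u' / z - e); have := r0 i.+1; nra.
Qed.

End nets.

(** * Counting zeros at one scale *)

Section zero_counting.
Context {R : realType} {X : Type} {S : set X} {phi : X -> Cplx R}
  {adm : set (X -> Cplx R)} {L : (X -> Cplx R) -> Cplx R} {M : R}.
Context (cf : cauchy_functional S phi adm L M).
Local Notation C := (Cplx R).
Local Notation N := (@Normc.normc R).
Local Notation d := (@pole_dist R X S phi).
Local Notation T := (@ctransform R X phi L).
Local Notation KW := (@kquos R X phi).

Lemma prod_ge_expr (I : eqType) (W : seq I) (F : I -> R) (c : R) : 0 <= c ->
  {in W, forall w, c <= F w} -> c ^+ size W <= \prod_(w <- W) F w.
Proof.
move=> c0; elim: W => [|w W IH] cF; first by rewrite big_nil.
rewrite big_cons /= exprS ler_pM ?exprn_ge0//.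
  by apply: cF; rewrite mem_head.
by apply: IH => v vW; apply: cF; rewrite inE vW orbT.
Qed.

Lemma prod_le_expr (I : eqType) (W : seq I) (F : I -> R) (c : R) :
  {in W, forall w, 0 <= F w <= c} -> \prod_(w <- W) F w <= c ^+ size W.
Proof.
elim: W => [|w W IH] cF; first by rewrite big_nil.
have /andP[F0 Fc] := cF w (mem_head _ _).
have cF' : {in W, forall w, 0 <= F w <= c}.
  by move=> v vW; apply: cF; rewrite inE vW orbT.
rewrite big_cons /= exprS ler_pM ?IH//.
by rewrite big_seq prodr_ge0// => v /cF'/andP[].
Qed.

(** Multiplicity is encoded by repetition. Asking for at most the order, not exactly the order,
    makes the notion stable under filtering. *)
Definition zero_list (k : X -> C) (W : seq C) :=
  exists2 n : C -> nat,
    {in W, forall w, 0 < d w /\ vanishes (T k) w (n w)} &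
    forall w, (count_mem w W <= n w)%N.

Lemma zero_list_filter k W (P : pred C) : zero_list k W -> zero_list k (seq.filter P W).
Proof.
move=> [n nW cW]; exists n; first by move=> w; rewrite mem_filter => /andP[_ /nW].
move=> w; apply: leq_trans (cW w); rewrite count_filter.
by apply: sub_count => x /andP[].
Qed.

Lemma zero_list_factor k W u : adm k -> zero_list k W -> 0 < d u ->
  T k u = \prod_(w <- W) (u - w) * T (KW k W) u.
Proof. by move=> ak [n nW cW]; exact: (vanishes_factor cf ak nW cW). Qed.

(** A linear factor at a zero [w] is at most [delta / 5] at [a], but at least [2 delta / 5] on the
    circle of radius [3 delta / 5] about [a]. The maximum principle for the quotient thus gains
    [1/2] per zero. *)
Lemma local_zero_bound k K W a delta : adm k ->
  (forall x, S x -> N (k x) <= K) -> 0 < delta ->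
  zero_list k W -> {in W, forall w, N (w - a) <= delta / 5 /\ delta <= d w} ->
  delta / 10 <= d a ->
  N (T k a) <= 2^-1 ^+ size W * (M * (K / (delta / 10))).
Proof.
move=> ak kK delta0 zW nW da.
have M0 := cf_norm_ge0 cf.
have K0 : 0 <= K by have [x /kK] := cf_supp cf; apply: le_trans.
have [x0 Sx0] := cf_supp cf.
have bnd u c : 0 < c -> c <= d u -> N (T k u) <= M * (K / c).
  move=> c0 cu; have du := lt_le_trans c0 cu.
  apply: le_trans (ctransform_le cf ak kK du) _.
  by rewrite ler_wpM2l// ler_wpM2l// lef_pV2 ?posrE.
(* Without zeros only the hypothesis [delta / 10 <= d a] is available; a zero close to [a] forces
   [d a >= 4 delta / 5], which leaves room for the circle. *)
case: W => [|w0 W'] in zW nW *.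
  by rewrite expr0 mul1r bnd// divr_gt0.
set W := w0 :: W' in zW nW *.
have da' : 4 * (delta / 5) <= d a.
  have [w0a w0d] := nW w0 (mem_head _ _).
  by have := pole_dist_lip cf w0 a; lra.
have {}da : 0 < d a by apply: lt_le_trans da'; rewrite mulr_gt0 ?divr_gt0.
have d5 : 0 < delta / 5 by rewrite divr_gt0.
pose rho := 3 * (delta / 5).
have rho0 : 0 <= rho by rewrite /rho; lra.
have rhoa : rho < d a by rewrite /rho; lra.
have dW : {in W, forall w, 0 < d w} by move: zW => [n nW' _] w /nW'[].
have aW : adm (KW k W) := adm_kquos cf ak dW.
have := poly_approx_max rho0 (ctransform_approx cf aW rho0 rhoa).
move=> /(_ (M * (K / (delta / 5)) / (2 * (delta / 5)) ^+ size W)) h.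
have {}h : N (T (KW k W) a) <=
    M * (K / (delta / 5)) / (2 * (delta / 5)) ^+ size W.
  rewrite -[a]addr0; apply: h => z zr.
  have dz : delta / 5 <= d (a + z).
    have := pole_dist_lip cf a (a + z).
    have -> : a - (a + z) = - z by ring.
    by rewrite modulusN zr /rho; lra.
  have c0 : 0 < (2 * (delta / 5)) ^+ size W by rewrite exprn_gt0// mulr_gt0.
  rewrite ler_pdivlMr// mulrC; apply: le_trans (bnd _ _ d5 dz).
  rewrite (zero_list_factor ak zW); last exact: lt_le_trans dz.
  rewrite modulusM ler_wpM2r// modulus_prod prod_ge_expr//; first by rewrite mulr_ge0// ltW.
  move=> w wW; have [wa _] := nW _ wW.
  have -> : a + z - w = z - (w - a) by ring.
  have := modulus_distD z (w - a) 0; rewrite !subr0 zr /rho; lra.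
rewrite (zero_list_factor ak zW da) modulusM modulus_prod.
have Pa : \prod_(w <- W) N (a - w) <= (delta / 5) ^+ size W.
  by apply: prod_le_expr => w /nW[wa _]; rewrite modulus_ge0 modulusB.
apply: le_trans (ler_pM _ _ Pa h) _ => //.
  by rewrite prodr_ge0.
have -> : (delta / 5) ^+ size W * (M * (K / (delta / 5)) / (2 * (delta / 5)) ^+ size W) =
    2^-1 ^+ size W * (M * (K / (delta / 5))).
  have E (x y : R) n : x != 0 -> x ^+ n * (y / (2 * x) ^+ n) = 2^-1 ^+ n * y.
    by move=> x00; rewrite exprMn exprVn; field; rewrite !expf_neq0.
  by rewrite E ?gt_eqF.
rewrite ler_wpM2l ?exprn_ge0// ler_wpM2l// ler_wpM2l//.
by rewrite lef_pV2 ?posrE ?divr_gt0//; lra.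
Qed.

Definition dyadic_zeros (j : nat) (w : C) : bool :=
  (N w <= 1) && ((2 ^+ j)^-1 <= d w <= 2 * (2 ^+ j)^-1).

Lemma zero_count k : adm k -> T k 0 != 0 -> exists E0 A : nat, forall W j,
  zero_list k W ->
  (count (dyadic_zeros j) W <= (E0 + j) * (A * 2 ^ j))%N.
Proof.
move=> ak Tk0; have [K K0 kK] := cf_bounded cf ak.
have M0 := cf_norm_ge0 cf.
have NT0 : 0 < N (T k 0) by rewrite modulus_gt0.
(* [E0] does not depend on the scale: the local bound [B] below equals [M * K * 10 * 2^j], so that
   [B / N (T k 0) <= 2^(E0 + j)]. *)
have [E0 E0P] : exists E0 : nat, M * K * 10 <= N (T k 0) * 2 ^+ E0.
  exists (Num.truncn (M * K * 10 / N (T k 0))).+1.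
  rewrite [leRHS]mulrC -ler_pdivrMr//; apply: ltW.
  have : 0 <= M * K * 10 / N (T k 0) by rewrite divr_ge0// !mulr_ge0.
  move=> /truncn_itv/andP[_]; set e := Num.truncn _ => h.
  by apply: lt_le_trans h _; rewrite -natrX ler_nat ltnW// ltn_expl.
exists E0, 3444%N => W0 j zW0.
pose delta : R := (2 ^+ j)^-1.
have j0 : 0 < 2 ^+ j :> R by rewrite exprn_gt0.
have delta0 : 0 < delta by rewrite invr_gt0.
have delta1 : delta <= 1 by rewrite invf_le1// exprn_ege1// ler1n.
rewrite -size_filter.
have zW := zero_list_filter (dyadic_zeros j) zW0.
set W := seq.filter _ W0 in zW *.
have WP : {in W, forall w, [/\ N w <= 1, delta <= d w & d w <= 2 * delta]}.
  by move=> w; rewrite mem_filter => /andP[/andP[? /andP[]]].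
have [E [sE E1 netE]] := @annulus_net R j.
apply: leq_trans (leq_mul (leqnn _) sE).
rewrite -/delta in E1 netE.
pose B := M * (K / (delta / 10)).
pose ce e z := seq.filter (fun w => N (w - e * z) <= delta / 5) W.
have Ge e z : N z = 1 -> e \in E -> N (T k (e * z)) <= 2^-1 ^+ size (ce e z) * B.
  move=> z1 eE; apply: local_zero_bound => //.
  - exact: zero_list_filter.
  - by move=> w; rewrite mem_filter => /andP[wa /WP[]].
  - have := pole_dist_ge1B cf (e * z).
    by rewrite modulusM z1 mulr1; have := E1 _ eE; lra.
(* Double counting: each zero satisfies [1 - |w| <= d w <= 2 delta], hence lies in the annulus
   covered by the rotated net and is counted by at least one [e]. *)
have sumE z : N z = 1 -> (size W <= \sum_(e <- E) size (ce e z))%N.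
  move=> z1; under eq_bigr do rewrite size_filter -sum1_count big_mkcond.
  rewrite exchange_big/= -sum1_size !big_seq.
  apply: leq_sum => w /WP[w1 dw1 dw2].
  have [|e eE we] := netE w z z1 _ w1.
    by have := pole_dist_ge1B cf w; lra.
  by rewrite (big_rem e)//= we leq_addr.
(* The zeros in the argument match [poly_approx_affine] applied to the expansion centred at [0]. *)
pose G z := \prod_(e <- E) T k (0 + (0 + e * z)).
have Gap : poly_approx 1 G.
  apply: poly_approx_prod => e eE.
  apply: (@poly_approx_affine _ (1 - delta / 10) 1 (fun z => T k (0 + z)) 0 e).
  - move=> z z1; rewrite add0r modulusM; have := E1 _ eE.
    have := modulus_ge0 e; have := modulus_ge0 z; nra.
  -
    apply: (ctransform_approx cf ak); first lra.
    by have := pole_dist_ge1B cf 0; rewrite modulus0; lra.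
have B0 : 0 <= B by rewrite mulr_ge0// divr_ge0// divr_ge0// ltW.
have := poly_approx_max ler01 Gap => /(_ (2^-1 ^+ size W * B ^+ size E)) h.
have {h} : N (G 0) <= 2^-1 ^+ size W * B ^+ size E.
  apply: h => z z1; rewrite modulus_prod.
  apply: (@le_trans _ _ (\prod_(e <- E) (2^-1 ^+ size (ce e z) * B))).
    rewrite !big_seq; apply: ler_prod => e eE.
    by rewrite modulus_ge0 /= !add0r Ge.
  rewrite big_split/= big_const_seq count_predT iter_mulr_1 ler_wpM2r ?exprn_ge0//.
  rewrite -expr_sum; apply: ler_wiXn2l; rewrite ?invr_ge0 ?sumE//.
  by rewrite invf_le1// ler1n.
rewrite /G modulus_prod; under eq_bigr do rewrite mulr0 !addr0.
rewrite big_const_seq count_predT iter_mulr_1.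
have BE : B <= N (T k 0) * 2 ^+ (E0 + j).
  rewrite exprD mulrA /B; have -> : M * (K / (delta / 10)) = M * K * 10 * 2 ^+ j.
    by rewrite /delta; field; rewrite gt_eqF.
  by rewrite ler_wpM2r// ltW.
have BE' : B ^+ size E <= N (T k 0) ^+ size E * 2 ^+ ((E0 + j) * size E).
  by rewrite exprM -exprMn lerXn2r ?nnegrE// mulr_ge0// exprn_ge0.
have h2 : 0 <= 2^-1 ^+ size W :> R by rewrite exprn_ge0.
move=> /le_trans/(_ (ler_wpM2l h2 BE')).
(* Cancelling [N (T k 0) ^+ size E] leaves [2^|W| <= 2^((E0 + j) |E|)], and the exponents are
   compared. *)
rewrite exprVn mulrCA -[leLHS]mulr1 ler_pM2l ?exprn_gt0//.
rewrite mulrC ler_pdivlMr ?exprn_gt0// mul1r.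
by rewrite ler_eXn2l// ltr1n.
Qed.

End zero_counting.

(** * Summation over dyadic scales *)

Section dyadic_summation.
Context {R : realType}.

(** The right-hand side [b(E)] is the value of the full series and satisfies
    [b(E) = E + q b(E + 1)], so the induction must range over all [E]. *)
Lemma arith_geom_bounded (q : R) (E n : nat) : 0 <= q < 1 ->
  \sum_(j < n) (E + j)%:R * q ^+ j <= E%:R / (1 - q) + q / (1 - q) ^+ 2.
Proof.
move=> /andP[q0 q1]; have q1' : 0 < 1 - q by rewrite subr_gt0.
elim: n E => [|n IH] E.
  by rewrite big_ord0 addr_ge0// divr_ge0// ?exprn_ge0// ltW.
rewrite big_ord_recl addn0 mulr1.
have -> : \sum_(i < n) (E + bump 0 i)%:R * q ^+ bump 0 i =
    q * \sum_(i < n) (E.+1 + i)%:R * q ^+ i.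
  rewrite mulr_sumr; apply: eq_bigr => i _.
  by rewrite /bump /= add1n addnS addSn exprS mulrCA.
have h := ler_wpM2l q0 (IH E.+1).
apply: le_trans (lerD (lexx _) h) _.
rewrite le_eqVlt; apply/orP; left; apply/eqP.
rewrite -natr1; field; rewrite gt_eqF//.
Qed.

Lemma dyadic_scale (x : R) : 0 < x <= 2 ->
  exists j, (2 ^+ j)^-1 <= x <= 2 * (2 ^+ j)^-1.
Proof.
move=> /andP[x0 x2].
have exP : exists j, (2 ^+ j)^-1 <= x.
  exists (Num.truncn x^-1).+1.
  rewrite invf_ple ?posrE ?exprn_gt0//.
  have : 0 <= x^-1 by rewrite invr_ge0 ltW.
  move=> /truncn_itv/andP[_]; set e := Num.truncn _ => h.
  apply/ltW/(lt_le_trans h); rewrite -natrX ler_nat ltnW// ltn_expl//.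
case: (ex_minnP exP) => j jx minj; exists j; rewrite jx/=.
(* Minimality says nothing when [j = 0]; there [x <= 2] is used. *)
case: j jx minj => [|j] jx minj; first by rewrite expr0 invr1 mulr1.
have : ~~ ((2 ^+ j)^-1 <= x).
  by apply/negP => /minj; rewrite ltnn.
rewrite -ltNge => /ltW/le_trans; apply.
by rewrite exprS invfM mulrA divff// mul1r.
Qed.

(** The number of zeros grows like [2^j] and each weighs about [2^(- j p)]; this ratio [2^(1 - p)]
    is where [p > 1] decides convergence. *)
Lemma powR_dyadic_ratio (p : R) : 1 < p -> 0 <= 2 * (2^-1 `^ p) < 1.
Proof.
move=> p1; have p0 : 0 < p by apply: lt_trans p1.
have h0 : 0 <= 2^-1 :> R by rewrite invr_ge0.
rewrite -mulr_powRB1// mulrA divff// mul1r powR_ge0/=.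
have one : 1 `^ (p - 1) = 1 :> R by rewrite powR1.
rewrite -[ltRHS]one; apply: gt0_ltr_powR.
- by rewrite subr_gt0.
- by rewrite nnegrE.
- by rewrite nnegrE.
- by rewrite invf_lt1// ltr1n.
Qed.

End dyadic_summation.

Section zero_summation.
Context {R : realType} {X : Type} {S : set X} {phi : X -> Cplx R}
  {adm : set (X -> Cplx R)} {L : (X -> Cplx R) -> Cplx R} {M : R}.
Context (cf : cauchy_functional S phi adm L M).
Local Notation C := (Cplx R).
Local Notation N := (@Normc.normc R).
Local Notation d := (@pole_dist R X S phi).
Local Notation T := (@ctransform R X phi L).

Lemma zero_list_sum k p : adm k -> T k 0 != 0 -> 1 < p ->
  exists B : R, forall W, @zero_list R X S phi L k W -> {in W, forall w, N w <= 1} ->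
    \sum_(w <- W) d w `^ p <= B.
Proof.
move=> ak Tk0 p1; have [E0 [A E0P]] := zero_count cf ak Tk0.
have p0 : 0 < p by apply: lt_trans p1.
set q := 2 * (2^-1 `^ p).
have q01 : 0 <= q < 1 := powR_dyadic_ratio p1.
exists (A%:R * 2 `^ p * (E0%:R / (1 - q) + q / (1 - q) ^+ 2)) => W zW W1.
have dW : {in W, forall w, 0 < d w} by case: zW => n nW _ w /nW[].
(* A finite list meets finitely many scales. Their number [m] depends on [W], but the final bound
   does not. *)
have [m mP] : exists m, {in W, forall w, exists2 j : 'I_m, @dyadic_zeros R X S phi j w & true}.
  elim: (W) W1 dW => [|w V IH] W1 dW; first by exists 0%N.
  have [||m mP] := IH.
  - by move=> v vV; apply: W1; rewrite inE vV orbT.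
  - by move=> v vV; apply: dW; rewrite inE vV orbT.
  have w1 := W1 w (mem_head _ _); have dw := dW w (mem_head _ _).
  have [|j jP] := @dyadic_scale R (d w).
    by rewrite dw/=; have := pole_dist_le1D cf w; lra.
  exists (maxn m j.+1) => v; rewrite inE => /orP[/eqP ->|/mP[i iP _]].
    have jm : (j < maxn m j.+1)%N by rewrite leq_maxr.
    by exists (Ordinal jm); rewrite // /dyadic_zeros w1.
  have im : (i < maxn m j.+1)%N by rewrite (leq_trans (ltn_ord i))// leq_maxl.
  by exists (Ordinal im).
pose c j : R := (2 * (2 ^+ j)^-1) `^ p.
have cE j : c j = 2 `^ p * (2^-1 `^ p) ^+ j.
  rewrite /c powRM ?invr_ge0 ?exprn_ge0//; congr (_ * _).
  by rewrite -exprVn -powR_mulrn ?invr_ge0// -powRrM mulrC powRrM powR_mulrn ?powR_ge0.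
(* A zero on the border of two scales is counted twice, which is harmless for an upper bound. *)
apply: (@le_trans _ _ (\sum_(w <- W) \sum_(j < m | @dyadic_zeros R X S phi j w) c j)).
  rewrite !big_seq; apply: ler_sum => w wW.
  have [j jw _] := mP w wW; rewrite (bigD1 j)//=.
  apply: ler_wpDr; first by rewrite sumr_ge0// => i _; rewrite powR_ge0.
  apply: ge0_ler_powR.
  - exact: ltW.
  - by rewrite nnegrE (pole_dist_ge0 cf).
  - by rewrite nnegrE mulr_ge0// invr_ge0 exprn_ge0.
  - by case/andP: jw => _ /andP[].
under eq_bigr do rewrite big_mkcond.
rewrite exchange_big /=.
apply: (@le_trans _ _ (\sum_(j < m) A%:R * 2 `^ p * ((E0 + j)%:R * q ^+ j))).
  apply: ler_sum => j _.
  rewrite -big_mkcond big_const_seq iter_addr_0.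
  apply: (@le_trans _ _ (((E0 + j) * (A * 2 ^ j))%:R * c j)).
    by rewrite -[leLHS]mulr_natl ler_wpM2r ?powR_ge0// ler_nat E0P.
  rewrite cE !natrM natrX /q exprMn le_eqVlt; apply/orP; left; apply/eqP; ring.
rewrite -mulr_sumr ler_wpM2l ?mulr_ge0 ?powR_ge0//.
exact: arith_geom_bounded.
Qed.

Lemma zero_sum k p : adm k -> T k 0 != 0 -> 1 < p ->
  exists B : R, forall (Z : seq C) (n : C -> nat), uniq Z ->
    {in Z, forall w, [/\ N w <= 1, 0 < d w & vanishes (T k) w (n w)]} ->
    \sum_(w <- Z) (n w)%:R * d w `^ p <= B.
Proof.
move=> ak Tk0 p1; have [B BP] := zero_list_sum ak Tk0 p1; exists B => Z n uZ ZP.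
pose W := flatten [seq nseq (n w) w | w <- Z].
have WZ w : w \in W -> w \in Z.
  by move=> /flatten_mapP[v vZ]; rewrite mem_nseq => /andP[_ /eqP ->].
have -> : \sum_(w <- Z) (n w)%:R * d w `^ p = \sum_(w <- W) d w `^ p.
  rewrite /W big_flatten big_map; apply: eq_bigr => w _.
  by rewrite big_nseq iter_addr_0 mulr_natl.
apply: BP; last by move=> w /WZ/ZP[].
exists n; first by move=> w /WZ/ZP[].
move=> w; rewrite /W count_flatten -map_comp sumnE big_map.
have [wZ|wZ] := boolP (w \in Z).
  rewrite (bigD1_seq w)//= count_nseq /= eqxx mul1n big1 ?addn0// => v vw.
  by rewrite count_nseq /= (negbTE vw).
rewrite big_seq big1// => v vZ; rewrite /= count_nseq /=.
by case: eqP => // vw; rewrite -vw vZ in wZ.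
Qed.

End zero_summation.

(** * Integration against a charge off a null set *)

Section integral_off_null_set.
Context d (T : measurableType d) (R : realType).
Context (m : {finite_measure set T -> \bar R}) (O : set T).
Hypotheses (mO : measurable O) (mO0 : m O = 0%E).

Lemma integrable_off_null (f : T -> R) (B : R) : measurable_fun [set: T] f ->
  (forall x, ~ O x -> `|f x| <= B) -> m.-integrable [set: T] (EFin \o f).
Proof.
move=> mf fB.
have mfE : measurable_fun [set: T] (EFin \o f) by apply/measurable_EFinP.
apply/(negligible_integrable mO measurableT mfE mO0).
rewrite setTD; apply: measurable_bounded_integrable.
- exact: measurableC.
- rewrite (le_lt_trans _ (fin_num_fun_lty (@fin_num_measure _ _ _ m)))//.
  by rewrite le_measure ?inE//; exact: measurableC.
- exact: measurable_funS mf.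
- exists B; split; first by rewrite num_real.
  by move=> y By x Ox /=; rewrite (le_trans (fB x Ox))// ltW.
Qed.

Lemma Rintegral_off_null_le (f : T -> R) (B : R) : measurable_fun [set: T] f ->
  (forall x, ~ O x -> `|f x| <= B) ->
  `|(\int[m]_x f x)%R| <= B * fine (m [set: T]).
Proof.
move=> mf fB; have intf := integrable_off_null mf fB.
have mOc : measurable (~` O) by exact: measurableC.
have intD : m.-integrable (~` O) (EFin \o f) by exact: integrableS measurableT mOc _ intf.
have cstD : m.-integrable (~` O) (EFin \o cst B).
  exact: finite_measure_integrable_cst.
have -> : (\int[m]_x f x)%R = (\int[m]_(x in ~` O) f x)%R.
  by rewrite /Rintegral (negligible_integral mO measurableT intf mO0) setTD.
apply: le_trans (le_normr_Rintegral mOc intD) _.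
apply: (@le_trans _ _ (\int[m]_(x in ~` O) cst B x)%R).
  apply: le_Rintegral => //.
  exact: integrable_norm.
rewrite Rintegral_cst//.
suff <- : m (~` O) = m [set: T] by [].
rewrite [RHS](measureDI m measurableT mO) setTI setTD.
by rewrite -[LHS]adde0; congr (_ + _)%E.
Qed.

End integral_off_null_set.

(** * Integrals against a charge that vanishes on a countable family of sets *)

Section charge_integral_theory.
Context d (T : measurableType d) (R : realType) (nu : {charge set T -> \bar R}).
Context (F : nat -> set T).
Hypotheses (mF : forall n, measurable (F n))
  (F0 : forall n (A : set T), measurable A -> A `<=` F n -> nu A = 0%E).
Local Notation O := (\bigcup_n F n).
Local Notation nuPN := (projT2 (cid (projT2 (cid (Hahn_decomposition nu))))).
Local Notation pos := (jordan_pos nuPN).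
Local Notation neg := (jordan_neg nuPN).

(** The positive part of [F n] is the charge of its trace on the Hahn positive set, a measurable
    subset of [F n]. This is why the charge is assumed to vanish on all measurable subsets;
    countable subadditivity then handles the union. *)
Lemma jordan_pos_null : pos O = 0%E.
Proof.
apply: measure_negligible; first exact: bigcup_measurable.
apply: negligible_bigcup => n; apply/negligibleP; first exact: mF.
rewrite -[LHS]/(jordan_pos nuPN (F n)) jordan_posE charge.cjordan_posE /crestr0 mem_set//.
apply: (F0 (n := n)) => //; apply: measurableI => //.
by case: (nuPN) => -[].
Qed.

Lemma jordan_neg_null : neg O = 0%E.
Proof.
apply: measure_negligible; first exact: bigcup_measurable.
apply: negligible_bigcup => n; apply/negligibleP; first exact: mF.
rewrite -[LHS]/(jordan_neg nuPN (F n)) jordan_negE charge.cjordan_negE /crestr0 mem_set//.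
rewrite /crestr (F0 (n := n)) ?oppe0//; apply: measurableI => //.
by case: (nuPN) => _ [].
Qed.

Definition bounded_off (f : T -> R) :=
  measurable_fun [set: T] f /\ exists B, forall x, ~ O x -> `|f x| <= B.

Let mO : measurable O. Proof. exact: bigcup_measurable. Qed.

Lemma bounded_off_pos f : bounded_off f -> pos.-integrable [set: T] (EFin \o f).
Proof. move=> [mf [B fB]]; exact: integrable_off_null mO jordan_pos_null _ _ mf fB. Qed.

Lemma bounded_off_neg f : bounded_off f -> neg.-integrable [set: T] (EFin \o f).
Proof. move=> [mf [B fB]]; exact: integrable_off_null mO jordan_neg_null _ _ mf fB. Qed.

Lemma charge_integralD f g : bounded_off f -> bounded_off g ->
  charge_integral nu (fun x => f x + g x) = charge_integral nu f + charge_integral nu g.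
Proof.
move=> bf bg; rewrite /charge_integral/= !RintegralD//;
  [|exact: bounded_off_neg..|exact: bounded_off_pos|exact: bounded_off_pos].
by ring.
Qed.

Lemma charge_integralZ r f : bounded_off f ->
  charge_integral nu (fun x => r * f x) = r * charge_integral nu f.
Proof.
move=> bf; rewrite /charge_integral/= !RintegralZl//;
  [|exact: bounded_off_neg|exact: bounded_off_pos].
by ring.
Qed.

Lemma charge_integral_le : exists2 M : R, 0 <= M & forall (f : T -> R) (B : R),
  measurable_fun [set: T] f -> (forall x, ~ O x -> `|f x| <= B) ->
  `|charge_integral nu f| <= M * B.
Proof.
exists (fine (pos [set: T]) + fine (neg [set: T])).
  by rewrite addr_ge0// fine_ge0.
move=> f B mf fB; rewrite /charge_integral/=.
apply: le_trans (ler_normB _ _) _; rewrite mulrC mulrDr; apply: lerD.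
  exact: Rintegral_off_null_le mO jordan_pos_null _ _ mf fB.
exact: Rintegral_off_null_le mO jordan_neg_null _ _ mf fB.
Qed.

Lemma charge_integral1 : charge_integral nu (cst 1) = fine (nu [set: T]).
Proof.
rewrite /charge_integral/= !Rintegral_cst// !mul1r.
rewrite [in RHS](jordan_decomp nuPN measurableT)//.
rewrite /cadd /= cscaleN1 fineB// fin_num_measure//.
Qed.

Lemma charge_integral0 : charge_integral nu (cst 0) = 0.
Proof. by rewrite /charge_integral/= !Rintegral_cst// !mul0r subrr. Qed.

End charge_integral_theory.

(** * Measurable functions on the circle *)

Section complex_topology.
Context {R : realType}.
Local Notation C := (Cplx R).
Local Notation N := (@Normc.normc R).

Lemma nbhs_modulusP (z : C) (V : set C) :
  nbhs z V <-> exists2 e : R, 0 < e & forall w, N (w - z) < e -> V w.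
Proof.
split=> [/nbhs_ballP[e /= e0 eV]|[e e0 eV]].
  have eE : e = ((complex.Re e)%:C)%C.
    by move: e0; case: (e) => a b; rewrite ltcE/= => /andP[/eqP -> _].
  exists (complex.Re e); first by rewrite -ltcR -eE.
  by move=> w we; apply: eV; rewrite /ball/= -normrN opprB eE modulusE ltcR.
apply/nbhs_ballP; exists (e%:C)%C; first by rewrite /= ltcR.
by move=> w; rewrite /ball/= -normrN opprB modulusE ltcR; exact: eV.
Qed.

Lemma open_modulusP (V : set C) :
  open V <-> forall z, V z -> exists2 e : R, 0 < e & forall w, N (w - z) < e -> V w.
Proof.
by rewrite openE; split=> VP z /VP /nbhs_modulusP.
Qed.

Lemma open_gt (f : C -> R) (a : R) : (forall z w, `|f z - f w| <= N (z - w)) ->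
  open [set z | a < f z].
Proof.
move=> lip; apply/open_modulusP => z /= az; exists (f z - a).
  by rewrite subr_gt0.
move=> w; have := lip z w; rewrite modulusB ler_norml => /andP[h1 h2] h3; lra.
Qed.

End complex_topology.

Section circle_functions.
Context {R : realType}.
Local Notation C := (Cplx R).
Local Notation N := (@Normc.normc R).
Local Notation T := (borel_circle R).

Definition cmeasurable_fun (f : T -> C) :=
  measurable_fun [set: T] (fun x => complex.Re (f x)) /\
  measurable_fun [set: T] (fun x => complex.Im (f x)).

Lemma circle_preimage_measurable (V : set C) : open V ->
  measurable (@circle_val R @^-1` V : set T).
Proof. by move=> oV; apply: sub_sigma_algebra; exists V. Qed.

Lemma measurable_circle_lipschitz (f : C -> R) :
  (forall z w, `|f z - f w| <= N (z - w)) ->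
  measurable_fun [set: T] (fun x => f (circle_val x)).
Proof.
move=> lip; apply: (measurability _ (RGenOInfty.measurableE R)).
move=> /= _ [_ [a ->] <-]; rewrite setTI.
have -> : (fun x => f (circle_val x)) @^-1` `]a, +oo[%classic =
    (@circle_val R @^-1` [set z | a < f z] : set T).
  by apply/seteqP; split => x /=; rewrite in_itv/= andbT.
by apply: circle_preimage_measurable; exact: open_gt.
Qed.

Lemma cmeasurable_cst c : cmeasurable_fun (fun=> c).
Proof. by split; exact: measurable_cst. Qed.

Lemma cmeasurable_val : cmeasurable_fun (@circle_val R).
Proof.
split; apply: measurable_circle_lipschitz => z w.
  by rewrite -raddfB modulus_Re.
by rewrite -raddfB modulus_Im.
Qed.

Lemma cmeasurable_conj f : cmeasurable_fun f -> cmeasurable_fun (fun x => (f x)^*).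
Proof.
move=> [mf1 mf2]; split.
  by under eq_fun => x do (have -> : complex.Re (f x)^* = complex.Re (f x) by case: (f x)).
under eq_fun => x do (have -> : complex.Im (f x)^* = - complex.Im (f x) by case: (f x)).
exact: measurable_funN.
Qed.

Lemma cmeasurableD f g : cmeasurable_fun f -> cmeasurable_fun g ->
  cmeasurable_fun (fun x => f x + g x).
Proof.
move=> [f1 f2] [g1 g2]; split.
  by under eq_fun do rewrite raddfD; exact: measurable_funD.
by under eq_fun do rewrite raddfD; exact: measurable_funD.
Qed.

Lemma complex_ReM (z w : C) : complex.Re (z * w) =
  complex.Re z * complex.Re w - complex.Im z * complex.Im w.
Proof. by case: z w => [a b] [c e]. Qed.

Lemma complex_ImM (z w : C) : complex.Im (z * w) =
  complex.Re z * complex.Im w + complex.Im z * complex.Re w.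
Proof. by case: z w => [a b] [c e]. Qed.

Lemma cmeasurableM f g : cmeasurable_fun f -> cmeasurable_fun g ->
  cmeasurable_fun (fun x => f x * g x).
Proof.
move=> [f1 f2] [g1 g2]; split.
  under eq_fun do rewrite complex_ReM.
  by apply: measurable_funB; exact: measurable_funM.
under eq_fun do rewrite complex_ImM.
by apply: measurable_funD; exact: measurable_funM.
Qed.

Lemma cmeasurableV f : cmeasurable_fun f -> cmeasurable_fun (fun x => (f x)^-1).
Proof.
move=> [f1 f2].
(* Written as a power, the inverse is measurable on the whole circle, with value [0] where [f]
   vanishes. *)
pose s x := (complex.Re (f x) ^+ 2 + complex.Im (f x) ^+ 2) `^ (-1).
have sE x : s x = (complex.Re (f x) ^+ 2 + complex.Im (f x) ^+ 2)^-1.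
  by rewrite /s powR_inv1// addr_ge0// sqr_ge0.
have ms : measurable_fun [set: T] s.
  apply: (measurableT_comp (measurable_powR (-1))).
  by apply: measurable_funD; exact: measurable_funX.
split.
  under eq_fun => x do (have -> : complex.Re (f x)^-1 = complex.Re (f x) * s x
    by rewrite sE; case: (f x)).
  exact: measurable_funM.
under eq_fun => x do (have -> : complex.Im (f x)^-1 = - (complex.Im (f x) * s x)
  by rewrite sE; case: (f x)).
by apply: measurable_funN; exact: measurable_funM.
Qed.

End circle_functions.

(** * Integration against a complex measure on the circle *)

Section integral_on_circle.
Context {R : realType} (mu : complex_measure (borel_circle R) R).
Local Notation C := (Cplx R).
Local Notation N := (@Normc.normc R).
Local Notation T := (borel_circle R).

(** [A], [U] minus [A] and then empty sets partition [U]; the first term of the series already gives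
    the bound. *)
Lemma total_variation_ge (U A : set T) : measurable U -> measurable A -> A `<=` U ->
  ((N (mu A))%:E <= Defs.total_variation mu U)%E.
Proof.
move=> mU mA AU; pose F := bigcup2 A (U `\` A).
have FS n : measurable (F n).
  by case: n => [//|[|n]] /=; [exact: measurableD|exact: measurable0].
apply: (@le_trans _ _ (\sum_(0 <= n <oo) (N (mu (F n)))%:E)%E); last first.
  apply: ereal_sup_ubound; exists F => //; split => //.
    by rewrite -trivIset_bigcup2 setDE setICA setICr setI0.
  by rewrite bigcup2E setDE setUIr setUCr setIT; apply/setUidPr.
have := @nneseries_lim_ge R (fun n => (N (mu (F n)))%:E) xpredT 0%N 1%N
  (fun n _ _ => modulus_ge0 _ : (0 <= (N (mu (F n)))%:E)%E).
by rewrite big_nat1.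
Qed.

Lemma rat_between (x y : R) : x < y -> exists q : rat, x < ratr q < y.
Proof. by move=> /rat_in_itvoo[q]; rewrite in_itv/=; exists q. Qed.

Lemma ltr_distl_right (x y e : R) : x < y -> y < x + e -> `|x - y| < e.
Proof. by move=> xy yx; rewrite ltr_norml; apply/andP; split; lra. Qed.

(** A Lindelöf argument: the traces of rational discs form a countable base, and those on which [mu]
    vanishes hereditarily cover the complement of the support. *)
Lemma support_null_cover : exists F : nat -> set T,
  [/\ forall n, measurable (F n),
      forall n A, measurable A -> A `<=` F n -> mu A = 0 &
      forall x, ~ closed_support mu x -> exists n, F n x].
Proof.
pose D (i : rat * rat * rat) : set C :=
  [set w | N (w - (ratr i.1.1 +i* ratr i.1.2)%C) < ratr i.2].
pose U i : set T := @circle_val R @^-1` D i.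
have oD i : open (D i).
  apply/open_modulusP => z zi; pose c : C := (ratr i.1.1 +i* ratr i.1.2)%C.
  exists (ratr i.2 - N (z - c)); first by rewrite subr_gt0.
  move=> w wz; rewrite /D /= -/c.
  by have := modulus_distD w z c; lra.
pose null i := forall A, measurable A -> A `<=` U i -> mu A = 0.
pose F n : set T := if unpickle n is Some i then
  (if `[< null i >] then U i else set0) else set0.
exists F; split.
- move=> n; rewrite /F; case: unpickle => [i|]; last exact: measurable0.
  case: ifP => _; last exact: measurable0.
  exact: circle_preimage_measurable.
- move=> n A mA; rewrite /F; case: unpickle => [i|]; last first.
    by rewrite subset0 => ->; exact: cmeasure0.
  case: ifPn => [/asboolP ni|_]; first exact: ni.
  by rewrite subset0 => ->; exact: cmeasure0.
move=> x /existsNP[V /not_implyP[oV /not_implyP[Vx tvV]]].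
have mV : measurable (V : set T) by exact: sub_sigma_algebra.
case: (oV) => W oW WV.
have Wx : W (circle_val x) by move: Vx; rewrite -WV.
have [e e0 eW] := (open_modulusP W).1 oW _ Wx.
(* A centre within [e / 8] in each coordinate is within [e / 4] of the point. A radius between
   [e / 4] and [e / 2] then captures the point and keeps the disc within [3 e / 4] of it. *)
have e8 : 0 < e / 8 by rewrite divr_gt0.
have /rat_between[a /andP[a1 a2]] :
  complex.Re (circle_val x) < complex.Re (circle_val x) + e / 8 by rewrite ltrDl.
have /rat_between[b /andP[b1 b2]] :
  complex.Im (circle_val x) < complex.Im (circle_val x) + e / 8 by rewrite ltrDl.
have /rat_between[r /andP[r1 r2]] : e / 4 < e / 2 by lra.
pose i := ((a, b), r).
have xc : N (circle_val x - (ratr a +i* ratr b)%C) < e / 4.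
  apply: le_lt_trans (modulus_le_ReIm _) _.
  have -> : complex.Re (circle_val x - (ratr a +i* ratr b)%C) =
    complex.Re (circle_val x) - ratr a by case: (circle_val x).
  have -> : complex.Im (circle_val x - (ratr a +i* ratr b)%C) =
    complex.Im (circle_val x) - ratr b by case: (circle_val x).
  have -> : e / 4 = e / 8 + e / 8 by field.
  by apply: ltrD; apply: ltr_distl_right.
have UV : U i `<=` V.
  move=> y Uy; rewrite -WV; apply: eW.
  apply: le_lt_trans (modulus_distD _ (ratr a +i* ratr b)%C _) _.
  rewrite [X in _ + X]modulusB; apply: lt_trans (ltrD Uy xc) _ => /=; lra.
exists (pickle i); rewrite /F pickleK; case: asboolP => [_|].
  by rewrite /U /D /=; apply: lt_trans r1.
case=> A mA AU; apply: contrapT => /eqP muA; apply: tvV.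
apply: lt_le_trans (total_variation_ge mV mA (subset_trans AU UV)).
by rewrite lte_fin modulus_gt0.
Qed.

Definition admissible (f : T -> C) :=
  cmeasurable_fun f /\
  exists2 B, 0 <= B & forall x, closed_support mu x -> N (f x) <= B.

Lemma Re_bounded f B : cmeasurable_fun f ->
  (forall x, closed_support mu x -> N (f x) <= B) ->
  measurable_fun [set: T] (fun x => complex.Re (f x)) /\
  forall x, closed_support mu x -> `|complex.Re (f x)| <= B.
Proof. by move=> [? _] fB; split => // x /fB; apply: le_trans (modulus_Re _). Qed.

Lemma Im_bounded f B : cmeasurable_fun f ->
  (forall x, closed_support mu x -> N (f x) <= B) ->
  measurable_fun [set: T] (fun x => complex.Im (f x)) /\
  forall x, closed_support mu x -> `|complex.Im (f x)| <= B.
Proof. by move=> [_ ?] fB; split => // x /fB; apply: le_trans (modulus_Im _). Qed.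

Lemma complex_integral1 : complex_integral mu (fun=> 1) = mu [set: T].
Proof.
rewrite /complex_integral.
rewrite -[X in charge_integral _ X - charge_integral _ _]/(cst 1).
rewrite -[X in charge_integral _ X + charge_integral _ _]/(cst 1).
rewrite -[X in _ - charge_integral _ X]/(cst 0) -[X in _ + charge_integral _ X]/(cst 0).
rewrite !charge_integral0 !charge_integral1 subr0 addr0.
by rewrite /= /cmeasure_re /cmeasure_im /=; case: (mu _).
Qed.

Lemma complex_integral_functional (phi : T -> C) :
  mu [set: T] <> 0 -> (forall x, N (phi x) = 1) -> cmeasurable_fun phi ->
  exists M : R, cauchy_functional (closed_support mu : set T) phi admissible
    (complex_integral mu) M.
Proof.
move=> muT phi1 mphi.
have [F [mF F0 cF]] := support_null_cover.
pose mu1 : {charge set T -> \bar R} := cmeasure_re mu.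
pose mu2 : {charge set T -> \bar R} := cmeasure_im mu.
have F1 n A : measurable A -> A `<=` F n -> mu1 A = 0%E.
  by move=> mA AF; rewrite /mu1/= /cmeasure_re (F0 n).
have F2 n A : measurable A -> A `<=` F n -> mu2 A = 0%E.
  by move=> mA AF; rewrite /mu2/= /cmeasure_im (F0 n).
have offS x : ~ (\bigcup_n F n) x -> closed_support mu x.
  by move=> nF; apply: contrapT => /cF[n Fx]; apply: nF; exists n.
have bRe f : admissible f -> bounded_off F (fun x => complex.Re (f x)).
  move=> [mf [B _ fB]]; have [? h] := Re_bounded mf fB.
  by split => //; exists B => x /offS/h.
have bIm f : admissible f -> bounded_off F (fun x => complex.Im (f x)).
  move=> [mf [B _ fB]]; have [? h] := Im_bounded mf fB.
  by split => //; exists B => x /offS/h.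
have bZ r f : bounded_off F f -> bounded_off F (fun x => r * f x).
  move=> [mf [B fB]]; split; first exact: measurable_funM.
  by exists (`|r| * B) => x xF; rewrite normrM ler_wpM2l// fB.
have bD f g : bounded_off F f -> bounded_off F g -> bounded_off F (fun x => f x + g x).
  move=> [mf [B fB]] [mg [B' gB]]; split; first exact: measurable_funD.
  exists (B + B') => x xF; apply: le_trans (ler_normD _ _) _.
  by rewrite lerD ?fB ?gB.
have D1 := charge_integralD mF F1; have D2 := charge_integralD mF F2.
have Z1 := charge_integralZ mF F1; have Z2 := charge_integralZ mF F2.
have [M1 M10 M1P] := charge_integral_le mF F1.
have [M2 M20 M2P] := charge_integral_le mF F2.
(* The real and the imaginary part of the integral each involve both charges, whence twice
   [M1 + M2]. *)
have le1 f B : cmeasurable_fun f ->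
    (forall x, closed_support mu x -> N (f x) <= B) ->
    N (complex_integral mu f) <= (2 * M1 + 2 * M2) * B.
  move=> mf fB; have [mR fR] := Re_bounded mf fB; have [mI fI] := Im_bounded mf fB.
  have R1 := M1P _ B mR (fun x h => fR x (offS x h)).
  have I1 := M1P _ B mI (fun x h => fI x (offS x h)).
  have R2 := M2P _ B mR (fun x h => fR x (offS x h)).
  have I2 := M2P _ B mI (fun x h => fI x (offS x h)).
  apply: le_trans (modulus_le_ReIm _) _; rewrite /complex_integral/=.
  apply: le_trans (lerD (ler_normB _ _) (ler_normD _ _)) _.
  rewrite -/mu1 -/mu2; lra.
have cE f : complex_integral mu f =
    ((charge_integral mu1 (fun x => complex.Re (f x)) -
      charge_integral mu2 (fun x => complex.Im (f x))) +i*
     (charge_integral mu2 (fun x => complex.Re (f x)) +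
      charge_integral mu1 (fun x => complex.Im (f x))))%C by [].
have addL f g : admissible f -> admissible g -> complex_integral mu (fun x => f x + g x) =
    complex_integral mu f + complex_integral mu g.
  move=> af ag; have [fr fi] := (bRe _ af, bIm _ af); have [gr gi] := (bRe _ ag, bIm _ ag).
  rewrite !cE.
  have -> : (fun x => complex.Re (f x + g x)) = (fun x => complex.Re (f x) + complex.Re (g x)).
    by apply/funext => x; rewrite raddfD.
  have -> : (fun x => complex.Im (f x + g x)) = (fun x => complex.Im (f x) + complex.Im (g x)).
    by apply/funext => x; rewrite raddfD.
  rewrite !D1// !D2//; congr (_ +i* _)%C; ring.
have scalL c f : admissible f ->
    complex_integral mu (fun x => c * f x) = c * complex_integral mu f.
  move=> af; have [fr fi] := (bRe _ af, bIm _ af).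
  rewrite !cE; case: c => a b.
  have -> : (fun x => complex.Re ((a +i* b)%C * f x)) =
      (fun x => a * complex.Re (f x) + (- b) * complex.Im (f x)).
    by apply/funext => x; rewrite complex_ReM mulNr.
  have -> : (fun x => complex.Im ((a +i* b)%C * f x)) =
      (fun x => a * complex.Im (f x) + b * complex.Re (f x)).
    by apply/funext => x; rewrite complex_ImM.
  have bZa r h : bounded_off F h -> bounded_off F (fun x => r * h x) by exact: bZ.
  rewrite !D1 ?D2//; do ?exact: bZ.
  rewrite !Z1// !Z2//; congr (_ +i* _)%C; ring.
have admC c : admissible (fun=> c).
  by split; [exact: cmeasurable_cst|exists (N c)].
exists (2 * M1 + 2 * M2); split => //.
(* With an empty support, [le1] applied to the constant [1] with [B = 0] would give [mu(T) = 0]. *)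
- apply: contrapT => /forallNP S0; apply: muT; apply/eqP.
  rewrite -complex_integral1.
  rewrite -modulus_eq0 eq_le modulus_ge0 andbT.
  rewrite -(mulr0 (2 * M1 + 2 * M2)); apply: le1; first exact: cmeasurable_cst.
  by move=> x /S0.
- move=> f g [mf [A A0 fA]] [mg [B B0 gB]]; split; first exact: cmeasurableD.
  exists (A + B); first exact: addr_ge0.
  by move=> x Sx; apply: le_trans (modulusD_le _ _) _; rewrite lerD ?fA ?gB.
- move=> f g [mf [A A0 fA]] [mg [B B0 gB]]; split; first exact: cmeasurableM.
  exists (A * B); first exact: mulr_ge0.
  by move=> x Sx; rewrite modulusM ler_pM ?fA ?gB.
- by split => //; exists 1 => // x _; rewrite phi1.
- move=> u c c0 cu; split.
    apply: cmeasurableV.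
    have -> : (fun x => 1 - phi x * u) = (fun x => 1 + phi x * (- u)).
      by apply/funext => x; rewrite mulrN.
    apply: cmeasurableD; first exact: cmeasurable_cst.
    by apply: cmeasurableM => //; exact: cmeasurable_cst.
  exists c^-1; first by rewrite invr_ge0 ltW.
  move=> x Sx; rewrite modulusV lef_pV2 ?posrE ?cu//.
  exact: lt_le_trans (cu _ Sx).
- by move=> f [].
- by move=> f B [mf _]; exact: le1.
Qed.

End integral_on_circle.

(** * The zeros inside and outside the disc *)

Section expansion_at_zero.
Context {R : realType} {X : Type} {S : set X} {phi : X -> Cplx R}
  {adm : set (X -> Cplx R)} {L : (X -> Cplx R) -> Cplx R} {M : R}.
Context (cf : cauchy_functional S phi adm L M).
Local Notation C := (Cplx R).
Local Notation N := (@Normc.normc R).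
Local Notation d := (@pole_dist R X S phi).
Local Notation T := (@ctransform R X phi L).

Lemma pole_dist0_gt0 : 0 < d 0.
Proof. by have := pole_dist_ge1B cf 0; rewrite modulus0 subr0; apply: lt_le_trans. Qed.

Lemma ctransform0 k : T k 0 = L k.
Proof.
by rewrite /ctransform; congr L; apply/funext => x; rewrite mulr0 subr0 invr1 mulr1.
Qed.

(** At the origin [kquo] is multiplication by [phi], so the Taylor coefficients are moments. *)
Lemma ctransform_powers k u n : adm k -> 0 < d u ->
  T k u = \sum_(i < n) u ^+ i * L (fun x => k x * phi x ^+ i)
    + u ^+ n * T (fun x => k x * phi x ^+ n) u.
Proof.
move=> ak du; have du' : 0 < d (0 + u) by rewrite add0r.
have iterE i : iter i (kquo (phi := phi) ^~ 0) k = (fun x => k x * phi x ^+ i).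
  elim: i => [|i IH] /=; first by apply/funext => x; rewrite mulr1.
  by rewrite IH; apply/funext => x; rewrite /kquo mulr0 subr0 invr1 mulr1 -mulrA -exprSr.
have := ctransform_expansion cf n ak pole_dist0_gt0 du'.
rewrite add0r iterE => ->; congr (_ + _); apply: eq_bigr => i _.
by rewrite ctransform0 iterE.
Qed.

End expansion_at_zero.

(** * Order of vanishing as a growth condition *)

Section big_o.
Context {R : realType}.
Local Notation C := (Cplx R).
Local Notation N := (@Normc.normc R).

(** Inversion need not map a ray to a ray, so transporting a zero from outside the disc requires a
    full neighbourhood instead of the single ray of [vanishes]. *)
Definition vanishes_near (g : C -> C) (w : C) (n : nat) :=
  exists A e : R, [/\ 0 <= A, 0 < e &
    forall z, N (z - w) < e -> N (g z) <= A * N (z - w) ^+ n].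

Lemma vanishes_near_vanishes g w n : vanishes_near g w n -> vanishes g w n.
Proof.
move=> [A [e [A0 e0 h]]]; exists A, 1, e; split => //; first exact: modulus1.
move=> t /andP[t0 te].
have wt : N (w + (t%:C)%C * 1 - w) = t.
  by rewrite mulr1 addrAC subrr add0r modulus_real gtr0_norm.
by have := h (w + (t%:C)%C * 1); rewrite wt; apply.
Qed.

Lemma factor_vanishes_near (g h : C -> C) (w : C) (n : nat) :
  (\forall z \near w, derivable h z 1 /\ g z = (z - w) ^+ n * h z) ->
  vanishes_near g w n.
Proof.
move=> gh; have [/derivable1_diffP/differentiable_continuous ch _] := nbhs_singleton gh.
have := ch; rewrite /prop_for /continuous_at => /cvgrPdist_lt/(_ 1 ltr01) hw.
have [e e0 He] := (nbhs_modulusP _ _).1 (filterI gh hw).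
exists (N (h w) + 1), e; split => //; first exact: addr_ge0.
move=> z /He[[_ ->]]; rewrite modulusE => hz.
rewrite modulusM modulusX mulrC ler_wpM2r ?exprn_ge0//.
have {}hz : N (h w - h z) < 1 by rewrite -ltcR.
have := modulus_distD (h z) (h w) 0; rewrite !subr0 modulusB; lra.
Qed.

End big_o.

Section zeros_of_cauchy_transform.
Context {R : realType} (mu : complex_measure (borel_circle R) R).
Local Notation C := (Cplx R).
Local Notation N := (@Normc.normc R).
Local Notation T := (borel_circle R).
Local Notation S := (closed_support mu : set T).
Local Notation L := (complex_integral mu).
Local Notation g := (cauchy_transform mu).
Local Notation cphi := (fun x : T => (circle_val x)^*).
Local Notation d1 := (@pole_dist R T S cphi).
Local Notation d2 := (@pole_dist R T S (@circle_val R)).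
Local Notation T1 := (@ctransform R T cphi L).
Local Notation T2 := (@ctransform R T (@circle_val R) L).

Lemma circle_val_modulus (x : T) : N (circle_val x) = 1.
Proof.
have : `|circle_val x| = 1 :> C := set_mem (valP (x : circle R)).
by rewrite modulusE => -[].
Qed.

Lemma circle_val_conj (x : T) : (circle_val x)^* * circle_val x = 1.
Proof.
rewrite mulrC -normCK modulusE circle_val_modulus.
by rewrite -rmorphXn expr1n.
Qed.

Lemma pole_modulus (x : T) (w : C) :
  N (1 - (circle_val x)^* * w) = N (w - circle_val x).
Proof.
rewrite -[LHS]mul1r -(circle_val_modulus x) -modulusM mulrBr mulr1 mulrA.
by rewrite (mulrC (circle_val x)) circle_val_conj mul1r modulusB.
Qed.

Lemma dist_support (w : C) : dist w (support_in_plane mu) = d1 w.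
Proof.
rewrite /dist /pole_dist; congr inf; apply/seteqP; split => r /=.
  by move=> [_ [x Sx <-] <-]; exists x => //; rewrite pole_modulus.
by move=> [x Sx <-]; exists (circle_val x); [exists x|rewrite pole_modulus].
Qed.

Lemma cauchy_transformE (w : C) : g w = T1 (fun=> 1) w.
Proof.
by rewrite /cauchy_transform /ctransform; congr L; apply/funext => x; rewrite mul1r.
Qed.

Hypothesis muT : mu [set: T] <> 0.

Lemma cf1 : exists M : R, cauchy_functional S cphi (admissible mu) L M.
Proof.
apply: complex_integral_functional => //.
  by move=> x; rewrite modulus_conj circle_val_modulus.
exact: cmeasurable_conj (cmeasurable_val).
Qed.

Lemma cf2 : exists M : R, cauchy_functional S (@circle_val R) (admissible mu) L M.
Proof.
apply: complex_integral_functional => //; last exact: cmeasurable_val.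
exact: circle_val_modulus.
Qed.

Lemma pole_dist_inversion w : w != 0 -> d1 w <= N w * d2 w^-1.
Proof.
move=> w0; have Nw : 0 < N w by rewrite modulus_gt0.
have [M cf] := cf2.
rewrite mulrC -ler_pdivrMr//; apply: (pole_dist_ge cf) => x Sx.
rewrite ler_pdivrMr//; apply: le_trans (pole_dist_le w Sx) _.
by rewrite pole_modulus -modulusM mulrBl mul1r mulfVK.
Qed.

Lemma adm_power n : admissible mu (fun x => circle_val x ^+ n).
Proof.
have [M cf] := cf2; elim: n => [|n IH]; first exact: (cf_adm_cst cf).
rewrite [X in admissible _ X](_ : _ = (fun x => circle_val x * circle_val x ^+ n)).
  exact: (cf_admM cf (cf_adm_phi cf) IH).
by apply/funext => x; rewrite exprS.
Qed.

(** On the circle the conjugate is the inverse, so the kernel at [u^-1] is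
    [- u * zeta / (1 - zeta * u)]. *)
Lemma cauchy_transform_inversion u : u != 0 -> 0 < d2 u ->
  g u^-1 = - u * T2 (fun x => circle_val x) u.
Proof.
move=> u0 du; have [M cf] := cf2; have [M1 cf'] := cf1.
have a1 : admissible mu (@circle_val R) := cf_adm_phi cf.
have aq := cf_admM cf a1 (adm_inv cf du).
rewrite /ctransform -(cf_scalar cf)//; apply: (cf_eq cf).
- apply: (cf_adm_inv cf' (c := d2 u / N u)).
    by rewrite divr_gt0 ?modulus_gt0.
  move=> x Sx; rewrite ler_pdivrMr ?modulus_gt0//.
  rewrite pole_modulus -modulusM mulrBl mulVf// .
  exact: pole_dist_le.
- exact: (cf_admM cf (cf_adm_cst cf _) aq).
move=> x Sx; have h1 := pole_neq0 du Sx.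
have x0 : circle_val x != 0 by rewrite -modulus_gt0 circle_val_modulus.
have -> : (circle_val x)^* = (circle_val x)^-1.
  by apply: (mulIf x0); rewrite circle_val_conj mulVf.
by field; rewrite h1 u0 x0 -oppr_eq0 opprB.
Qed.

(** The first [m] moments kill the first [m] Taylor terms; the exponent is [m + 1] because inversion
    itself contributes a factor [u]. *)
Lemma cauchy_transform_power m u :
  (forall i, (i < m)%N -> L (fun x => circle_val x ^+ i.+1) = 0) ->
  u != 0 -> 0 < d2 u ->
  g u^-1 = - u ^+ m.+1 * T2 (fun x => circle_val x ^+ m.+1) u.
Proof.
move=> Lm u0 du; have [M cf] := cf2.
rewrite cauchy_transform_inversion// (ctransform_powers cf m (cf_adm_phi cf) du).
rewrite big1 ?add0r; last first.
  move=> i _; under [X in L X]eq_fun do rewrite -exprS.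
  by rewrite Lm ?mulr0.
under [X in T2 X]eq_fun do rewrite -exprS.
by rewrite mulrA mulNr -exprS.
Qed.

Lemma modulus_V_gt1 (w : C) : 1 < N w -> [/\ w != 0, w^-1 != 0 & N w^-1 < 1].
Proof.
move=> w1; have w0 : w != 0 by rewrite -modulus_gt0 (lt_trans ltr01).
by rewrite invr_eq0 modulusV invf_lt1 ?modulus_gt0.
Qed.

Lemma pole_dist2_gt0 u : N u < 1 -> 0 < d2 u.
Proof.
by have [M cf] := cf2; have := pole_dist_ge1B cf u; move=> ? ?; lra.
Qed.

Lemma inner_zero_sum p : 1 < p ->
  exists B : R, forall (Z : seq C) (n : C -> nat), uniq Z ->
    {in Z, forall w, [/\ N w <= 1, 0 < d1 w & vanishes g w (n w)]} ->
    \sum_(w <- Z) (n w)%:R * d1 w `^ p <= B.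
Proof.
move=> p1; have [M cf] := cf1.
have T10 : T1 (fun=> 1) 0 != 0.
  by rewrite ctransform0 complex_integral1; apply/eqP.
have [B BP] := zero_sum cf (cf_adm_cst cf 1) T10 p1.
exists B => Z n uZ ZP; apply: BP => // w /ZP[? ? vw]; split => //.
by rewrite (_ : T1 _ = g)//; apply/funext => z; rewrite cauchy_transformE.
Qed.

Lemma off_support_dist (x : T) : ~ S x -> 0 < d1 (circle_val x).
Proof.
move=> /existsNP[V /not_implyP[oV /not_implyP[Vx tvV]]].
have [M cf] := cf1.
case: (oV) => W oW WV.
have Wx : W (circle_val x) by move: Vx; rewrite -WV.
have [e e0 eW] := (open_modulusP W).1 oW _ Wx.
apply: (lt_le_trans e0); apply: (pole_dist_ge cf) => y Sy.
rewrite pole_modulus modulusB leNgt; apply/negP => /eW Wy; apply: tvV.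
by apply: Sy => //; rewrite -WV.
Qed.

(* If all the moments vanished, then the transform would vanish identically
   outside the closed disc, hence to infinite order along the outward ray at a
   point of the circle off the support. *)
Lemma nonzero_moment : S <> [set: T] ->
  exists m, L (fun x => circle_val x ^+ m.+1) != 0.
Proof.
move=> ST; apply: contrapT => /forallNP L0.
have {}L0 m : L (fun x => circle_val x ^+ m.+1) = 0.
  by apply: contrapT => /eqP; exact: L0.
have [M cf] := cf2.
have g0 w : 1 < N w -> g w = 0.
  move=> /modulus_V_gt1[w0 u0 u1]; have du := pole_dist2_gt0 u1.
  rewrite -[w]invrK; apply/eqP; rewrite -modulus_eq0 eq_le modulus_ge0 andbT.
  set u := w^-1 in u0 u1 du *; set D := M * (1 / d2 u).
  (* With all moments zero this holds for every [m], with [D] independent of [m]; since [|u| < 1],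
     the value is zero. *)
  have gD m : N (g u^-1) <= D * N u ^+ m.+1.
    rewrite (cauchy_transform_power (m := m))// modulusM modulusN modulusX mulrC.
    rewrite ler_wpM2r ?exprn_ge0//; apply: (ctransform_le cf) => //.
      exact: adm_power.
    by move=> x _; rewrite modulusX circle_val_modulus expr1n.
  have D0 : 0 <= D by rewrite mulr_ge0 ?(cf_norm_ge0 cf)// divr_ge0// ltW.
  apply/ler_addgt0Pr => e e0; rewrite add0r.
  have [|n Dn] := @geometric_small R D (N u) e D0 _ e0.
    by rewrite modulus_ge0.
  apply: le_trans (gD n) (le_trans _ Dn); rewrite ler_wpM2l//.
  by rewrite exprS ler_piMl ?exprn_ge0// ltW.
have [x nSx] : exists x, ~ S x.
  by apply: contrapT => /forallNP h; apply: ST; apply/seteqP; split => // x _; apply: contrapT.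
have dx := off_support_dist nSx.
(* Any exponent above [1] would do. The point [x] may be listed as a zero of every order [n], so
   [n * d^2] would stay bounded although [d > 0]. *)
have two1 : 1 < 2 :> R by rewrite ltr1n.
have [B BP] := inner_zero_sum two1.
have dp : 0 < d1 (circle_val x) `^ 2 by rewrite powR_gt0.
have h n : n%:R * d1 (circle_val x) `^ 2 <= B.
  have := BP [:: circle_val x] (fun=> n) isT; rewrite big_seq1; apply.
  move=> w; rewrite inE => /eqP ->; split => //; first by rewrite circle_val_modulus.
  exists 0, (circle_val x), 1; split => //; first exact: circle_val_modulus.
  move=> t /andP[t0 _]; rewrite g0 ?modulus0 ?mul0r//.
  rewrite -[X in X + _]mul1r -mulrDl modulusM circle_val_modulus mulr1.
  have -> : 1 + (t%:C)%C = ((1 + t)%:C)%C :> C by rewrite rmorphD rmorph1.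
  by rewrite modulus_real gtr0_norm ?addr_gt0// ltrDl.
have := h (Num.truncn (B / d1 (circle_val x) `^ 2)).+1.
have B0 : 0 <= B by have := h 0%N; rewrite mul0r.
rewrite -ler_pdivlMr// leNgt => /negP; apply.
have := truncn_itv (divr_ge0 B0 (ltW dp)).
by case/andP.
Qed.

Lemma outer_zero_sum p : S <> [set: T] -> 1 < p ->
  exists B : R, forall (Z : seq C) (n : C -> nat), uniq Z ->
    {in Z, forall w, [/\ 1 < N w, 0 < d1 w, g w = 0 & vanishes_near g w (n w)]} ->
    \sum_(w <- Z) (n w)%:R * d1 w `^ p <= B.
Proof.
move=> ST p1; have p0 : 0 < p by apply: lt_trans p1.
have [M cf] := cf2.
case: (ex_minnP (nonzero_moment ST)) => m Lm minm.
have {minm} Lmin i : (i < m)%N -> L (fun x => circle_val x ^+ i.+1) = 0.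
  move=> im; apply/eqP; apply: contraTT im => /minm.
  by rewrite leqNgt.
have gm u := cauchy_transform_power Lmin (u := u).
set k := fun x : T => circle_val x ^+ m.+1.
have ak : admissible mu k := adm_power m.+1.
have k1 x : S x -> N (k x) <= 1.
  by rewrite /k modulusX circle_val_modulus expr1n.
have Tk0 : T2 k 0 != 0 by rewrite ctransform0.
have [B2 BP] := zero_sum cf ak Tk0 p1.
have M0 := cf_norm_ge0 cf.
(* [T2 k 0 != 0] keeps the points [1 / w] away from 0 *)
pose c := Num.min 2^-1 (N (T2 k 0) / (2 * M + 1)).
have M1 : 0 < 2 * M + 1 by lra.
have c0 : 0 < c by rewrite lt_min invr_gt0 ltr0n divr_gt0 ?modulus_gt0.
have zc w : 1 < N w -> g w = 0 -> N w <= c^-1.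
  move=> w1 gw; have [w0 u0 u1] := modulus_V_gt1 w1.
  have du := pole_dist2_gt0 u1.
  have := gm _ u0 du; rewrite invrK gw => /esym/eqP.
  rewrite mulf_eq0 oppr_eq0 expf_eq0 (negbTE u0) andbF/= => /eqP Tu.
  rewrite -[N w]invrK -modulusV lef_pV2 ?posrE ?modulus_gt0// .
  (* When [|u| <= 1/2], expansion at [0] gives [T2 k 0 = - u * q] with [|q| <= 2 M], because
     [d2 u >= 1/2] and [d2 0 >= 1]. Hence [u] cannot be too small. *)
  have [u2|u2] := leP (N w^-1) 2^-1; last by rewrite ge_min (ltW u2).
  have := ctransform_sub cf ak du (pole_dist0_gt0 cf); rewrite Tu subr0.
  move=> /esym/eqP; rewrite addr_eq0 => /eqP T0.
  rewrite ge_min; apply/orP; right; rewrite ler_pdivrMr// T0 modulusN modulusM.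
  have := ctransform_le cf (adm_kquo cf ak (pole_dist0_gt0 cf))
    (fun x Sx => kquo_le cf (k1 x Sx) (pole_dist0_gt0 cf) Sx) du.
  set t := N (T2 _ _) => tM.
  have d01 : 1 <= d2 0 by have := pole_dist_ge1B cf 0; rewrite modulus0 subr0.
  have du2 : 2^-1 <= d2 w^-1 by have := pole_dist_ge1B cf w^-1; lra.
  have tM2 : t <= 2 * M.
    apply: le_trans tM _; rewrite mulrC ler_wpM2r// div1r -invfM.
    rewrite invf_ple ?posrE ?mulr_gt0// ?(pole_dist0_gt0 cf)//.
    by apply: le_trans du2 _; rewrite ler_peMl// ltW.
  by rewrite ler_wpM2l//; lra.
have B20 : 0 <= B2.
  have := BP [::] (fun=> 0%N) isT; rewrite big_nil; exact.
(* Inversion changes the distance by at most the factor [|w| <= c^-1], by [pole_dist_inversion] and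
   [zc]. *)
exists ((c^-1) `^ p * B2) => Z n uZ ZP.
have invZ : uniq [seq w^-1 | w <- Z] by rewrite map_inj_uniq//; exact: invr_inj.
have := BP [seq w^-1 | w <- Z] (fun u => n u^-1) invZ.
rewrite big_map => h.
apply: le_trans (ler_wpM2l (powR_ge0 _ _) (h _)).
  rewrite mulr_sumr !big_seq; apply: ler_sum => w /ZP[w1 dw gw vw].
  have [w0 u0 u1] := modulus_V_gt1 w1.
  rewrite invrK mulrCA ler_wpM2l//.
  rewrite -powRM ?invr_ge0 ?(ltW c0) ?(pole_dist_ge0 cf)//.
  apply: ge0_ler_powR; first exact: ltW.
  - by rewrite nnegrE ltW.
  - by rewrite nnegrE mulr_ge0 ?invr_ge0 ?(ltW c0) ?(pole_dist_ge0 cf).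
  apply: le_trans (pole_dist_inversion w0) _.
  by rewrite ler_wpM2r ?(pole_dist_ge0 cf)// zc.
move=> _ /mapP[w /ZP[w1 dw gw vw] ->]; rewrite invrK.
have [w0 u0 u1] := modulus_V_gt1 w1; have du := pole_dist2_gt0 u1.
split=> //; first exact: ltW.
case: vw => A [e [A0 e0 Ae]].
set u := w^-1 in u0 u1 du *.
have Nu : 0 < N u by rewrite modulus_gt0.
(* Lipschitz constant of inversion on the ray: [|z^-1 - w| = t / (|z| |u|)] and [|z| >= |u| / 2]
   there. *)
pose s := (N u / 2)^-1 / N u.
have s0 : 0 < s by rewrite divr_gt0// invr_gt0 divr_gt0.
exists (A * s ^+ n w / (N u / 2) ^+ m.+1), 1, (Num.min (e / s) (Num.min (N u / 2) (1 - N u))).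
split; first by rewrite !lt_min subr_gt0 u1 (divr_gt0 e0 s0) divr_gt0.
  exact: modulus1.
move=> t /andP[t0]; rewrite !lt_min => /and3P[te tu t1]; rewrite mulr1.
set z := u + (t%:C)%C.
have Nt : N (t%:C)%C = t by rewrite modulus_real gtr0_norm.
have Nz1 : N z < 1 by have := modulusD_le u (t%:C)%C; rewrite Nt -/z; lra.
have Nz2 : N u / 2 <= N z.
  have := modulusB_le z (t%:C)%C; rewrite Nt /z addrK -/z; lra.
have Nz : 0 < N z by apply: lt_le_trans Nz2; rewrite divr_gt0.
have z0 : z != 0 by rewrite -modulus_gt0.
have zw : N (z^-1 - w) <= s * t.
  have -> : z^-1 - w = - ((t%:C)%C / (z * u)).
    rewrite -[w]invrK -/u /z; field.
    by rewrite u0 -/z z0.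
  rewrite modulusN modulusM modulusV modulusM Nt mulrC invfM.
  by rewrite ler_wpM2r ?(ltW t0)// ler_wpM2r ?invr_ge0// lef_pV2 ?posrE ?divr_gt0.
have Tz : T2 k z = - g z^-1 / z ^+ m.+1.
  rewrite (gm z z0 (pole_dist2_gt0 Nz1)) !mulNr opprK.
  by rewrite mulrAC divff ?mul1r// expf_neq0.
rewrite Tz modulusM modulusN modulusV modulusX.
have zA : N (g z^-1) <= A * s ^+ n w * t ^+ n w.
  apply: le_trans (Ae _ _) _.
    by apply: le_lt_trans zw _; rewrite mulrC -ltr_pdivlMr.
  by rewrite -mulrA -exprMn ler_wpM2l// lerXn2r ?nnegrE// mulr_ge0 ?(ltW s0) ?(ltW t0).
have -> : A * s ^+ n w / (N u / 2) ^+ m.+1 * t ^+ n w =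
  A * s ^+ n w * t ^+ n w * ((N u / 2) ^+ m.+1)^-1 by rewrite mulrAC.
apply: ler_pM => //; first by rewrite invr_ge0 exprn_ge0.
rewrite lef_pV2 ?posrE ?exprn_gt0 ?divr_gt0//.
by rewrite lerXn2r ?nnegrE ?divr_ge0.
Qed.

End zeros_of_cauchy_transform.

(** * All zeros together, and finiteness of their orders *)

Section all_zeros.
Context {R : realType} (mu : complex_measure (borel_circle R) R).
Local Notation C := (Cplx R).
Local Notation N := (@Normc.normc R).
Local Notation S := (closed_support mu : set (borel_circle R)).
Local Notation g := (cauchy_transform mu).
Local Notation d w := (dist w (support_in_plane mu)).
Hypotheses (suppT : S <> [set: borel_circle R]) (muT : mu [set: borel_circle R] <> 0).

Lemma dist_ge0 w : 0 <= d w.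
Proof. by rewrite dist_support; have [M cf] := cf1 muT; exact: pole_dist_ge0 cf w. Qed.

Lemma all_zero_sum p : 1 < p ->
  exists B : R, forall (Z : seq C) (n : C -> nat), uniq Z ->
    {in Z, forall w, [/\ 0 < d w, g w = 0 & vanishes_near g w (n w)]} ->
    \sum_(w <- Z) (n w)%:R * d w `^ p <= B.
Proof.
move=> p1; have [B1 B1P] := inner_zero_sum muT p1.
have [B2 B2P] := outer_zero_sum muT suppT p1.
exists (B1 + B2) => Z n uZ ZP.
rewrite (bigID (fun w => N w <= 1))/= -big_filter -[X in _ + X]big_filter.
under eq_bigr do rewrite dist_support.
under [X in _ + X]eq_bigr do rewrite dist_support.
apply: lerD.
  apply: B1P; first exact: filter_uniq.
  move=> w; rewrite mem_filter => /andP[w1 /ZP[dw gw vw]].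
  by split; rewrite -?dist_support//; exact: vanishes_near_vanishes.
apply: B2P; first exact: filter_uniq.
move=> w; rewrite mem_filter -ltNge => /andP[w1 /ZP[dw gw vw]].
by split; rewrite -?dist_support.
Qed.

(** Local boundedness of [g] provides the starting order for the maximum taken in
    [zero_order_attained]. *)
Lemma vanishes_near0 w : 0 < d w -> vanishes_near g w 0.
Proof.
rewrite dist_support => dw; have [M cf] := cf1 muT.
have d2 : 0 < pole_dist (S := S) (phi := fun x => (circle_val x)^*) w / 2 by rewrite divr_gt0.
exists (M * (1 / (pole_dist (S := S) (phi := fun x => (circle_val x)^*) w / 2))).
exists (pole_dist (S := S) (phi := fun x => (circle_val x)^*) w / 2).
split=> //; first by rewrite mulr_ge0 ?(cf_norm_ge0 cf)// divr_ge0// ltW.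
move=> z zw; rewrite expr0 mulr1 cauchy_transformE.
have dz := pole_dist_lip cf w z; rewrite modulusB in dz.
have {}dz : pole_dist (S := S) (phi := fun x => (circle_val x)^*) w / 2 <=
  pole_dist (S := S) (phi := fun x => (circle_val x)^*) z by lra.
have dz0 := lt_le_trans d2 dz.
apply: le_trans (ctransform_le cf (K := 1) (cf_adm_cst cf 1) _ dz0) _.
  by move=> x _; rewrite modulus1.
by rewrite ler_wpM2l ?(cf_norm_ge0 cf)// ler_wpM2l// lef_pV2 ?posrE.
Qed.

(** The summation bound applied to the single zero [w] gives [n * d(w)^p <= B] for every admissible
    order [n]. Orders are thus finite without an appeal to the identity theorem. *)
Lemma zero_order_attained (p : R) w : 1 < p -> g w = 0 -> 0 < d w ->
  exists2 n : nat, (zero_order g w <= (n%:R : R)%:E)%E & vanishes_near g w n.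
Proof.
move=> p1 gw dw; have [B BP] := all_zero_sum p1.
have dp : 0 < d w `^ p by rewrite powR_gt0.
have bnd n : vanishes_near g w n -> n%:R * d w `^ p <= B.
  move=> vn; have := BP [:: w] (fun=> n) isT; rewrite big_seq1; apply.
  by move=> z; rewrite inE => /eqP ->.
have exn : exists n, `[< vanishes_near g w n >].
  by exists 0%N; apply/asboolP; exact: vanishes_near0.
have ub n : `[< vanishes_near g w n >] -> (n <= Num.truncn (B / d w `^ p))%N.
  move=> /asboolP/bnd; rewrite -ler_pdivlMr// => nB.
  by rewrite truncn_ge_nat// (le_trans _ nB).
case: (ex_maxnP exn ub) => n /asboolP vn maxn; exists n => //.
apply: ge_ereal_sup => _ [k [h gh] <-]; rewrite lee_fin ler_nat maxn//.
by apply/asboolP; exact: factor_vanishes_near gh.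
Qed.

End all_zeros.

Theorem theorem3 (R : realType) (mu : complex_measure (borel_circle R) R)
    (supp_neqT : closed_support mu <> [set: circle R])
    (muT_neq0 : mu [set: borel_circle R] <> 0)
    (p : R) (p_gt1 : 1 < p) :
  let g := cauchy_transform mu in
  let S := support_in_plane mu in
  (\esum_(w in [set w : Cplx R | ~ S w /\ g w = 0%R])
     (zero_order g w * (dist w S `^ p)%:E) < +oo)%E.
Proof.
cbv zeta; set g := cauchy_transform mu; set S := support_in_plane mu.
have p0 : 0 < p by apply: lt_trans p_gt1.
have [B BP] := all_zero_sum supp_neqT muT_neq0 p_gt1.
have exn w : exists k : nat, g w = 0 -> 0 < dist w S ->
    (zero_order g w <= (k%:R : R)%:E)%E /\ vanishes_near g w k.
  have [[gw dw]|h] := pselect (g w = 0 /\ 0 < dist w S); last first.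
    by exists 0%N => gw dw; case: h.
  by have [k ? ?] := zero_order_attained supp_neqT muT_neq0 p_gt1 gw dw; exists k.
have [n nP] := choice exn.
apply: (@le_lt_trans _ _ B%:E); last exact: ltry.
(* The sum is a supremum over finite sets of zeros, so the uniform bound [B] suffices. *)
apply: ge_ereal_sup => _ [F [finF FZ] <-].
rewrite fsbig_finite//.
pose Z := [seq w <- finmap.enum_fset (fset_set F) | 0 < dist w S].
have uZ : uniq Z by rewrite filter_uniq// finmap.fset_uniq.
have FP w : w \in finmap.enum_fset (fset_set F) -> g w = 0.
  by rewrite in_fset_set// inE => /FZ[].
apply: (@le_trans _ _ (\sum_(w <- Z) (n w)%:R * dist w S `^ p)%:E); last first.
  rewrite lee_fin; apply: BP => // w; rewrite mem_filter => /andP[dw /FP gw].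
  by split => //; case: (nP w gw dw).
rewrite /Z big_filter -sumEFin [leRHS]big_mkcond !big_seq.
apply: lee_sum => w /FP gw; case: ifPn => [dw|].
  rewrite EFinM lee_wpmul2r ?lee_fin ?powR_ge0//.
  by case: (nP w gw dw).
(* Terms with distance zero vanish because [0] to the power [p] is [0] and [0] absorbs even an
   infinite order; closedness of the support in the plane need not be proved. *)
rewrite -leNgt => dw.
have -> : dist w S = 0.
  by apply/eqP; rewrite eq_le dw dist_ge0.
by rewrite powR0 ?gt_eqF// mule0.
Qed.
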